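(* Let $m\neq 0$ and $\lambda$ be real constants. The Bianchi V spacetime with metric, in coordinates $(\tau,x,y,z)$, $$ds^{2}=A^{2}(\tau)\left[\Gamma^{2}(\tau)\left(-d\tau^{2}+dx^{2}\right)+e^{2x}\left(B^{2}(\tau)\,dy^{2}+dz^{2}\right)\right],$$ where $A,\Gamma,B$ are smooth nowhere vanishing functions of $\tau$, admits the unique proper conformal Killing vector (CKV) $$\mathbf{L}_{1}=\frac{2}{m}\partial_{\tau}+y\,\partial_{y}+\lambda z\,\partial_{z},\qquad\text{with conformal factor}\qquad \psi_{(V)}(\mathbf{L}_{1})=\frac{2}{m}\frac{A_{,\tau}}{A}+\lambda,$$ only when $$\Gamma^{2}(\tau)=e^{m\lambda\tau},\qquad B^{2}(\tau)=e^{m(\lambda-1)\tau}.$$ For $A^{2}(\tau)=e^{m(\kappa-\lambda)\tau}$, with $\kappa\neq 0$ a constant (and $\Gamma$, $B$ as just given), the CKV $\mathbf{L}_1$ reduces to a homothetic vector with constant conformal factor $\psi_{(V)}(\mathbf{L}_{1})=\kappa\neq 0$.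
   Context: A conformal Killing vector (CKV) of a metric $g_{ab}$ is a vector field $\mathbf{X}$ with $L_{\mathbf{X}}g_{ab}=2\psi g_{ab}$ for some function $\psi$, called the conformal factor ($L_{\mathbf X}$ is the Lie derivative). It is a Killing vector (KV) if $\psi=0$, a homothetic vector (HV) if $\psi$ is constant, a special CKV if $\psi_{;ab}=0$, and a proper CKV if $\psi_{;ab}\neq 0$, where $;$ denotes the covariant derivative of $g_{ab}$. A comma denotes a partial derivative, so $A_{,\tau}=dA/d\tau$. Uniqueness of the proper CKV is understood modulo constant multiples and addition of Killing vectors. A Bianchi V spacetime is a four-dimensional Lorentzian manifold with metric of the (diagonal) form $$ds^{2}=-dt^{2}+a^{2}(t)\,dx^{2}+b^{2}(t)\,e^{2x}dy^{2}+c^{2}(t)\,e^{2x}dz^{2},$$ with $a,b,c$ nowhere vanishing smooth functions of $t$; the form used in the statement is obtained by introducing $\tau$ with $dt=a\,d\tau$ and setting $a^2=A^2\Gamma^2$, $b^2=A^2B^2$, $c^2=A^2$.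
   Formalization: The formulas for Γ² and B² are necessary only up to constant factors, removed by rescaling y and z; L₁ is proper only if ψ is not constant; uniqueness is stated for λ≠1 and m²λ≠4, since extra conformal vectors exist in those cases. *)

(* Defs.v *)
From HB Require Import structures.
From mathcomp Require Import all_boot all_order all_algebra.
From mathcomp Require Import all_classical all_reals all_analysis.
Set Implicit Arguments.
Unset Strict Implicit.
Unset Printing Implicit Defensive.
Import Order.TTheory GRing.Theory Num.Theory.
Import numFieldNormedType.Exports.

Local Open Scope classical_set_scope.
Local Open Scope ring_scope.

(* Tensor fields in one coordinate chart: a point is a row vector P of
   coordinates, a vector field is its row of components, a metric its matrix of
   components.  Fields are total functions, and only their restriction to the
   open coordinate domain M is meaningful. *)

Definition partial (R : realType) (n : nat) (i : 'I_n.+1)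
    (f : 'rV[R]_n.+1 -> R) (P : 'rV[R]_n.+1) : R :=
  'D_(delta_mx 0 i) f P.

Fixpoint Ck (R : realType) (n k : nat) (M : set 'rV[R]_n.+1)
    (f : 'rV[R]_n.+1 -> R) : Prop :=
  match k with
  | 0%N => forall P, M P -> {for P, continuous f}
  | k'.+1 => [/\ forall P, M P -> {for P, continuous f},
                forall P i, M P -> derivable f P (delta_mx 0 i) &
                forall i, Ck k' M (partial i f)]
  end.

Definition smooth (R : realType) (n : nat) (M : set 'rV[R]_n.+1)
    (f : 'rV[R]_n.+1 -> R) : Prop := forall k, Ck k M f.

Definition smooth1 (R : realType) (J : set R) (f : R -> R) : Prop :=
  forall k t, J t -> derivable (derive1n k f) t 1.

Definition vector_field (R : realType) (n : nat) (M : set 'rV[R]_n.+1)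
    (X : 'rV[R]_n.+1 -> 'rV[R]_n.+1) : Prop :=
  forall a, smooth M (fun P => X P 0 a).

Definition lie_metric (R : realType) (n : nat)
    (X : 'rV[R]_n.+1 -> 'rV[R]_n.+1) (g : 'rV[R]_n.+1 -> 'M[R]_n.+1)
    (P : 'rV[R]_n.+1) : 'M[R]_n.+1 :=
  \matrix_(a, b)
    (\sum_c X P 0 c * partial c (fun Q => g Q a b) P
     + \sum_c g P c b * partial a (fun Q => X Q 0 c) P
     + \sum_c g P a c * partial b (fun Q => X Q 0 c) P).

(* christoffel g c a b P is the Levi-Civita symbol with upper index c. *)
Definition christoffel (R : realType) (n : nat)
    (g : 'rV[R]_n.+1 -> 'M[R]_n.+1) (c a b : 'I_n.+1) (P : 'rV[R]_n.+1) : R :=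
  2^-1 * \sum_d invmx (g P) c d *
    (partial a (fun Q => g Q d b) P + partial b (fun Q => g Q a d) P
     - partial d (fun Q => g Q a b) P).

Definition cov_hessian (R : realType) (n : nat)
    (g : 'rV[R]_n.+1 -> 'M[R]_n.+1) (psi : 'rV[R]_n.+1 -> R)
    (P : 'rV[R]_n.+1) : 'M[R]_n.+1 :=
  \matrix_(a, b)
    (partial b (partial a psi) P
     - \sum_c christoffel g c a b P * partial c psi P).

Definition CKV (R : realType) (n : nat) (M : set 'rV[R]_n.+1)
    (g : 'rV[R]_n.+1 -> 'M[R]_n.+1) (X : 'rV[R]_n.+1 -> 'rV[R]_n.+1)
    (psi : 'rV[R]_n.+1 -> R) : Prop :=
  vector_field M X /\ forall P, M P -> lie_metric X g P = (2 * psi P) *: g P.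

Definition KV (R : realType) (n : nat) (M : set 'rV[R]_n.+1)
    (g : 'rV[R]_n.+1 -> 'M[R]_n.+1) (X : 'rV[R]_n.+1 -> 'rV[R]_n.+1) : Prop :=
  CKV M g X (fun _ => 0).

Definition HV (R : realType) (n : nat) (M : set 'rV[R]_n.+1)
    (g : 'rV[R]_n.+1 -> 'M[R]_n.+1) (X : 'rV[R]_n.+1 -> 'rV[R]_n.+1)
    (k : R) : Prop :=
  CKV M g X (fun _ => k).

(* "proper" negates the identical vanishing of the Hessian on M. *)
Definition proper_CKV (R : realType) (n : nat) (M : set 'rV[R]_n.+1)
    (g : 'rV[R]_n.+1 -> 'M[R]_n.+1) (X : 'rV[R]_n.+1 -> 'rV[R]_n.+1)
    (psi : 'rV[R]_n.+1 -> R) : Prop :=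
  CKV M g X psi /\ exists2 P, M P & cov_hessian g psi P != 0.

Definition unique_proper_CKV (R : realType) (n : nat) (M : set 'rV[R]_n.+1)
    (g : 'rV[R]_n.+1 -> 'M[R]_n.+1) (X : 'rV[R]_n.+1 -> 'rV[R]_n.+1)
    (psi : 'rV[R]_n.+1 -> R) : Prop :=
  proper_CKV M g X psi /\
  forall Y phi, proper_CKV M g Y phi ->
    exists c K, KV M g K /\ forall P, M P -> Y P = c *: X P + K P.

(* With row vectors, the differential of f at P acts by v |-> v *m 'J f P. *)
Definition pullback (R : realType) (n : nat)
    (f : 'rV[R]_n.+1 -> 'rV[R]_n.+1) (g : 'rV[R]_n.+1 -> 'M[R]_n.+1)
    (P : 'rV[R]_n.+1) : 'M[R]_n.+1 :=
  jacobian f P *m g (f P) *m (jacobian f P)^T.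

Definition preserves_field (R : realType) (n : nat)
    (f : 'rV[R]_n.+1 -> 'rV[R]_n.+1) (X : 'rV[R]_n.+1 -> 'rV[R]_n.+1)
    (P : 'rV[R]_n.+1) : Prop :=
  X P *m jacobian f P = X (f P).

Definition tc {R : realType} (P : 'rV[R]_4) : R := P 0 (inord 0).
Definition xc {R : realType} (P : 'rV[R]_4) : R := P 0 (inord 1).
Definition yc {R : realType} (P : 'rV[R]_4) : R := P 0 (inord 2).
Definition zc {R : realType} (P : 'rV[R]_4) : R := P 0 (inord 3).

Definition row4 {R : realType} (a b c d : R) : 'rV[R]_4 :=
  \row_(i < 4) [:: a; b; c; d]`_i.

Definition slab {R : realType} (J : set R) : set 'rV[R]_4 := [set P | J (tc P)].

Definition bianchiV {R : realType} (A Gam B : R -> R) (P : 'rV[R]_4) :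
    'M[R]_4 :=
  A (tc P) ^+ 2 *:
  diag_mx (row4 (- Gam (tc P) ^+ 2) (Gam (tc P) ^+ 2)
                (expR (2 * xc P) * B (tc P) ^+ 2) (expR (2 * xc P))).

Definition L1 {R : realType} (m lam : R) (P : 'rV[R]_4) : 'rV[R]_4 :=
  row4 (2 / m) 0 (yc P) (lam * zc P).

Definition psiV {R : realType} (m lam : R) (A : R -> R) (t : R) : R :=
  2 / m * (derive1 A t / A t) + lam.

(* Rescalings of y and z preserve the form of the metric and the field L1. They
   act on (A, Gam, B) by (q A, Gam / q, (p / q) B), so that multiplicative
   constants in Gam and B are gauge. *)
Definition rescale {R : realType} (p q : R) (P : 'rV[R]_4) : 'rV[R]_4 :=
  row4 (tc P) (xc P) (p * yc P) (q * zc P).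

(* Main.v *)
Require Import Defs.
From HB Require Import structures.
From mathcomp Require Import all_boot all_order all_algebra.
From mathcomp Require Import all_classical all_reals all_analysis.
From mathcomp Require Import ring lra.
Set Implicit Arguments.
Unset Strict Implicit.
Unset Printing Implicit Defensive.
Import Order.TTheory GRing.Theory Num.Theory.
Import numFieldNormedType.Exports.

Local Open Scope classical_set_scope.
Local Open Scope ring_scope.

(* The conformal Killing equations do not see the factor A^2 except through the
   conformal factor, so they reduce to equations for the metric
     e^{m lam t - 2 x} (- dt^2 + dx^2) + e^{m (lam - 1) t} dy^2 + dz^2,
   a product of a line with a 3-metric. For L1 the diagonal equations are
   ordinary differential equations that give Gam and B up to constants. For an
   arbitrary field (T, X, W, Z), the equations say that the 3-metric Hessian of Z
   is pure trace; comparing third derivatives of Z computed in two orders leaves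
   a linear system in dZ whose determinant is a multiple of lam - 1 and
   m^2 lam - 4, so Z depends on z only. What remains is a homothety of the
   3-metric, and a second comparison of mixed derivatives makes T and X constant
   and W, Z affine; such a field is m T / 2 times L1 plus a Killing vector.
   If the Hessian of psi vanishes, its zz component gives A' psi' = 0, hence
   u u' = 0 for u = A' / A, so u^2, u and psi are constant. *)

(** * Derivatives along lines and symmetry of second derivatives *)

(** Both difference quotients are the same function of the increment. This opens directional
    derivatives to the one-variable chain rule and mean value theorem. *)
Lemma is_derive_line (R : realType) (V : normedModType R) (f : V -> R)
    (P v : V) (s df : R) :
  is_derive s 1 (fun r : R => f (r *: v + P)) df <->
  is_derive (s *: v + P) v f df.
Proof.
have E : (fun h : R => h^-1 *: (((fun r => f (r *: v + P)) \o shift s) (h *: 1)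
              - f (s *: v + P))) =
         (fun h : R => h^-1 *: ((f \o shift (s *: v + P)) (h *: v)
              - f (s *: v + P))).
  by apply/funext => h /=; rewrite [h *: 1]mulr1 scalerDl addrA.
by split=> -[d1 d2]; split; rewrite /derivable /derive ?E // in d1 d2 *.
Qed.

Lemma is_derive_comp1 (R : realType) (V : normedModType R) (f : V -> R)
    (phi : R -> R) (P v : V) (df dphi : R) :
  is_derive P v f df -> is_derive (f P) 1 phi dphi ->
  is_derive P v (fun Q => phi (f Q)) (dphi * df).
Proof.
move=> Hf Hphi; rewrite -[P]add0r -(scale0r v).
apply/(is_derive_line (fun Q => phi (f Q)) P v 0).
apply: (@is_derive1_comp _ phi); first by rewrite scale0r add0r.
by apply/is_derive_line; rewrite scale0r add0r.
Qed.

Lemma is_derive_cst_line (R : realType) (V : normedModType R) (f : V -> R)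
    (P v : V) : (forall s, f (s *: v + P) = f P) -> is_derive P v f 0.
Proof.
move=> Hf; rewrite -[P]add0r -(scale0r v).
apply/(is_derive_line f P v 0).
rewrite (_ : (fun _ => _) = cst (f P)); first exact: is_derive_cst.
by apply/funext => s; rewrite Hf.
Qed.

Lemma MVT_line (R : realType) (V : normedModType R) (f df : V -> R) (P v : V)
    (h : R) :
  0 < h ->
  (forall s, 0 <= s <= h -> is_derive (s *: v + P) v f (df (s *: v + P))) ->
  exists2 s, 0 <= s <= h & f (h *: v + P) - f P = df (s *: v + P) * h.
Proof.
move=> h0 Hf.
have [||s] := @MVT_segment R (fun r => f (r *: v + P))
   (fun r => df (r *: v + P)) 0 h (ltW h0).
- move=> s; rewrite in_itv /= => /andP[s0 sh].
  by apply/is_derive_line/Hf; rewrite !ltW.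
- apply: derivable_within_continuous => s; rewrite in_itv /= => sh.
  by have /is_derive_line[] := Hf _ sh.
- rewrite in_itv /= => sh; rewrite scale0r add0r subr0 => E.
  by exists s.
Qed.

(** The mean value theorem is used twice: along [u] for the increment Q -> f (Q + h w) - f Q, then
    along [w] for [fu]. *)
Lemma second_difference (R : realType) (V : normedModType R) (f fu fuw : V -> R)
    (P u w : V) (h : R) :
  0 < h ->
  (forall s r, 0 <= s <= h -> 0 <= r <= h ->
    is_derive (s *: u + (r *: w + P)) u f (fu (s *: u + (r *: w + P))) /\
    is_derive (r *: w + (s *: u + P)) w fu (fuw (r *: w + (s *: u + P)))) ->
  exists s r, [/\ 0 <= s <= h, 0 <= r <= h &
    f (h *: u + (h *: w + P)) - f (h *: u + P) - (f (h *: w + P) - f P)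
      = fuw (r *: w + (s *: u + P)) * h ^+ 2].
Proof.
move=> h0 H.
have hh : 0 <= h <= h by rewrite (ltW h0) /=.
have h00 : 0 <= (0 : R) <= h by rewrite lexx (ltW h0).
have [|s sh E] := @MVT_line R V (fun Q => f (Q + h *: w) - f Q)
  (fun Q => fu (Q + h *: w) - fu Q) P u h h0.
  move=> s sh; apply: is_deriveB.
    have [/is_derive_line D _] := H s h sh hh.
    apply/is_derive_line; rewrite -addrA [P + _]addrC.
    by under eq_fun do rewrite -addrA [P + _]addrC.
  by have [] := H s 0 sh h00; rewrite scale0r add0r.
have [|r rh E'] := @MVT_line R V fu fuw (s *: u + P) w h h0.
  by move=> r rh; have [] := H s r sh rh.
exists s, r; split=> //.
rewrite expr2 mulrA -E' [h *: w + (s *: u + P)]addrC -[RHS]E.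
by rewrite [h *: w + P]addrC [h *: u + (P + _)]addrA.
Qed.

Lemma dist_half_le (R : realType) (x y z e : R) :
  `|x - z| < e / 2 -> `|y - z| < e / 2 -> `|x - y| <= e.
Proof.
move=> xz yz; apply: le_trans (ler_distD z _ _) _.
by rewrite [leRHS]splitr lerD // ltW // distrC.
Qed.

(** Schwarz's theorem. The second difference is symmetric in [u] and [w], so the two mixed
    derivatives agree at some pair of points near [P]; continuity at [P] moves both points to
    [P]. *)
Lemma derive_comm (R : realType) (V : normedModType R) (M : set V) (f : V -> R)
    (P u w : V) :
  open M -> M P ->
  (forall Q, M Q -> derivable f Q u) -> (forall Q, M Q -> derivable f Q w) ->
  (forall Q, M Q -> derivable ('D_u f) Q w) ->
  (forall Q, M Q -> derivable ('D_w f) Q u) ->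
  {for P, continuous ('D_w ('D_u f))} -> {for P, continuous ('D_u ('D_w f))} ->
  'D_w ('D_u f) P = 'D_u ('D_w f) P.
Proof.
move=> oM MP fu fw fuw fwu cuw cwu.
apply/eqP; rewrite -subr_eq0 -normr_le0; apply/ler_addgt0Pr => e e0.
rewrite add0r.
have e2 : 0 < e / 2 by rewrite divr_gt0.
have H0 : \forall Q \near P, M Q by exact: open_nbhs_nbhs.
have H1 := (cvgrPdist_lt _ _).1 cuw _ e2.
have H2 := (cvgrPdist_lt _ _).1 cwu _ e2.
have [d /= d0 Hd] := (nbhs_ballP P _).1 (filterI H0 (filterI (H1 _) (H2 _))).
(* The summand 1 keeps [c] positive when [u] and [w] both vanish. With h = d / c the parallelogram
   spanned by h u and h w stays in the ball of radius [d]. *)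
set c := `|u| + `|w| + 1.
have c0 : 0 < c by rewrite /c ltr_wpDl // addr_ge0.
set h := d / c.
have h0 : 0 < h by rewrite divr_gt0.
have inb (s r : R) : 0 <= s <= h -> 0 <= r <= h -> ball P d (s *: u + (r *: w + P)).
  move=> /andP[s0 sh] /andP[r0 rh].
  rewrite -ball_normE /=.
  have -> : P - (s *: u + (r *: w + P)) = - (s *: u + r *: w).
    by rewrite addrA opprD addrCA subrr addr0.
  rewrite normrN.
  apply: le_lt_trans (ler_normD _ _) _.
  rewrite !normrZ !ger0_norm //.
  apply: (@le_lt_trans _ _ (h * (`|u| + `|w|))).
    by rewrite mulrDr lerD // ler_wpM2r.
  rewrite /h mulrAC ltr_pdivrMr // ltr_pM2l // /c ltrDl //.
have swap (s r : R) (a b : V) : r *: b + (s *: a + P) = s *: a + (r *: b + P).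
  by rewrite addrCA.
have [|s [r [sh rh E]]] := @second_difference R V f ('D_u f) ('D_w ('D_u f)) P u w h h0.
  move=> s r sh rh; have [MQ _] := Hd _ (inb _ _ sh rh).
  by split; apply: derivableP; [exact: fu|rewrite swap; exact: fuw].
have [|s' [r' [sh' rh' E']]] :=
    @second_difference R V f ('D_w f) ('D_u ('D_w f)) P w u h h0.
  move=> s' r' sh' rh'; have [MQ _] := Hd _ (inb _ _ rh' sh').
  by split; apply: derivableP; [rewrite swap; exact: fw|exact: fwu].
have EQ : 'D_w ('D_u f) (r *: w + (s *: u + P)) =
          'D_u ('D_w f) (r' *: u + (s' *: w + P)).
  have h2 : h ^+ 2 != 0 by rewrite expf_neq0 // gt_eqF.
  rewrite (addrCA (h *: w) (h *: u) P) in E'.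
  apply: (mulIf h2); rewrite -[LHS]E -[RHS]E'.
  ring.
rewrite swap in EQ.
have [_ [K1 _]] := Hd _ (inb _ _ sh rh); have [_ [_ K2]] := Hd _ (inb _ _ rh' sh').
rewrite /= -EQ in K2.
exact: dist_half_le K1 K2.
Qed.

(** * Smooth functions and coordinate derivatives on an open set *)

Section Partial.
Variables (R : realType) (n : nat) (M : set 'rV[R]_n.+1).
Hypothesis M_open : open M.
Implicit Types (f g : 'rV[R]_n.+1 -> R) (P : 'rV[R]_n.+1) (i j : 'I_n.+1).

Lemma smooth_partial f i : smooth M f -> smooth M (partial i f).
Proof. by move=> sf k; have [_ _] := sf k.+1; apply. Qed.

Lemma smooth_is_derive f P i : smooth M f -> M P ->
  is_derive P (delta_mx 0 i) f (partial i f P).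
Proof. by move=> sf MP; have [_ df _] := sf 1%N; exact/derivableP/df. Qed.

Lemma partial_comm f P i j : smooth M f -> M P ->
  partial i (partial j f) P = partial j (partial i f) P.
Proof.
move=> sf MP; have d g Q k : smooth M g -> M Q -> derivable g Q (delta_mx 0 k).
  by move=> sg MQ; have [_ dg _] := sg 1%N; exact: dg.
have c g : smooth M g -> {for P, continuous g} by move=> /(_ 0%N); apply.
apply: (derive_comm M_open MP); try by move=> *; apply: d => //; apply: smooth_partial.
- by apply: c; do 2 apply: smooth_partial.
- by apply: c; do 2 apply: smooth_partial.
Qed.

Lemma partial_eq f g P i : (forall Q, M Q -> f Q = g Q) -> M P ->
  partial i f P = partial i g P.
Proof.
move=> fg MP; apply: near_eq_derive.
by apply: filterS (open_nbhs_nbhs (conj M_open MP)).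
Qed.

End Partial.

Lemma smooth_cst (R : realType) (n : nat) (M : set 'rV[R]_n.+1) (a : R) :
  smooth M (fun _ => a).
Proof.
move=> k; elim: k a => [|k IH] a /=; first by move=> P _; exact: cst_continuous.
split=> [P _|P i _|i]; [exact: cst_continuous|exact: derivable_cst|].
rewrite (_ : partial i _ = fun _ => 0) //.
by apply/funext => P; apply: derive_cst.
Qed.

Lemma is_derive_coord (R : realType) (n : nat) (i j : 'I_n.+1) (P : 'rV[R]_n.+1) :
  is_derive P (delta_mx 0 j) (fun Q : 'rV[R]_n.+1 => Q 0 i) (i == j)%:R.
Proof.
rewrite -[P]add0r -(scale0r (delta_mx 0 j)); apply/is_derive_line.
rewrite (_ : (fun _ => _) = (id * cst (i == j)%:R) + cst (P 0 i)).
  by apply: is_derive_eq; rewrite /= scaler0 add0r addr0 [LHS]mulr1.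
by apply/funext => r; rewrite !mxE eqxx.
Qed.

Lemma smooth_affine_coord (R : realType) (n : nat) (M : set 'rV[R]_n.+1)
    (i : 'I_n.+1) (a c : R) :
  smooth M (fun P => a * P 0 i + c).
Proof.
have A (r : R) : is_derive r 1 (fun r : R => a * r + c) a.
  rewrite (_ : (fun _ => _) = (cst a * id) + cst c) //.
  by apply: is_derive_eq; rewrite /= scaler0 !addr0 [LHS]mulr1.
have D (P : 'rV[R]_n.+1) j :
    is_derive P (delta_mx 0 j) (fun P => a * P 0 i + c) (a * (i == j)%:R).
  exact: (@is_derive_comp1 R _ (fun Q : 'rV[R]_n.+1 => Q 0 i)
            (fun r => a * r + c) P _ _ a (is_derive_coord i j P)).
have C (P : 'rV[R]_n.+1) :
    {for P, continuous (fun P : 'rV[R]_n.+1 => a * P 0 i + c)}.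
  apply: (@continuous_comp _ _ _ (fun Q : 'rV[R]_n.+1 => Q 0 i)
            (fun r => a * r + c)); first exact: coord_continuous.
  by apply/differentiable_continuous/derivable1_diffP; case: (A (P 0 i)).
case=> [|k]; first by move=> P _; exact: C.
split=> [P _|P j _|j]; [exact: C|by case: (D P j)|].
rewrite (_ : partial j _ = fun _ => a * (i == j)%:R); first exact: smooth_cst.
by apply/funext => P; case: (D P j).
Qed.

(** * Functions on a slab *)

(** Indices come out as [inord k], the form used by [tc], [xc], [yc] and [zc], so that later
    rewriting matches them. *)
Lemma ord4P (T : 'I_4 -> Prop) :
  T (inord 0) -> T (inord 1) -> T (inord 2) -> T (inord 3) -> forall i, T i.
Proof.
move=> T0 T1 T2 T3 [[|[|[|[|//]]]] Hi].
- by rewrite (_ : Ordinal Hi = inord 0) //; apply/val_inj; rewrite /= inordK.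
- by rewrite (_ : Ordinal Hi = inord 1) //; apply/val_inj; rewrite /= inordK.
- by rewrite (_ : Ordinal Hi = inord 2) //; apply/val_inj; rewrite /= inordK.
- by rewrite (_ : Ordinal Hi = inord 3) //; apply/val_inj; rewrite /= inordK.
Qed.

Lemma sum4E (V : nmodType) (F : 'I_4 -> V) :
  \sum_i F i = F (inord 0) + F (inord 1) + F (inord 2) + F (inord 3).
Proof.
rewrite !big_ord_recl big_ord0 addr0 !addrA.
by congr (F _ + F _ + F _ + F _); apply/val_inj; rewrite /= inordK.
Qed.

Lemma inord4_eq (a b : nat) : (a < 4)%N -> (b < 4)%N ->
  (inord a == inord b :> 'I_4) = (a == b).
Proof. by move=> a4 b4; rewrite -val_eqE /= !inordK. Qed.

Lemma row4E (R : realType) (a b c d : R) :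
  (row4 a b c d 0 (inord 0) = a) * (row4 a b c d 0 (inord 1) = b) *
  (row4 a b c d 0 (inord 2) = c) * (row4 a b c d 0 (inord 3) = d).
Proof. by rewrite !mxE !inordK. Qed.

Lemma row4_eta (R : realType) (v : 'rV[R]_4) :
  v = row4 (v 0 (inord 0)) (v 0 (inord 1)) (v 0 (inord 2)) (v 0 (inord 3)).
Proof. by apply/rowP; apply: ord4P; rewrite !row4E. Qed.

Lemma open_slab (R : realType) (J : set R) : open J -> open (slab J).
Proof.
move=> oJ; apply: (@open_comp _ _ (fun P : 'rV[R]_4 => P 0 (inord 0))) => //.
by move=> P _; apply: coord_continuous.
Qed.

Section Slab.
Variables (R : realType) (J : set R).
Hypothesis J_itv : is_interval J.

Lemma tc_line (s : R) i (P : 'rV[R]_4) :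
  tc (s *: delta_mx 0 i + P) = s * (inord 0 == i)%:R + tc P.
Proof. by rewrite /tc !mxE eqxx. Qed.

Lemma slab_line (s : R) i (P : 'rV[R]_4) : 0 <= s ->
  slab J P -> slab J (s *: delta_mx 0 i + P) ->
  forall r, 0 <= r <= s -> slab J (r *: delta_mx 0 i + P).
Proof.
move=> s0 JP JQ r /andP[r0 rs]; rewrite /slab /= in JP JQ *.
apply: (J_itv JP JQ); rewrite !tc_line lerDr mulr_ge0 //=.
by rewrite lerD2r ler_wpM2r.
Qed.

Lemma cst_derive_step (f : 'rV[R]_4 -> R) (i : 'I_4) (c s : R) (P : 'rV[R]_4) :
  (forall Q, slab J Q -> is_derive Q (delta_mx 0 i) f c) ->
  slab J P -> slab J (s *: delta_mx 0 i + P) ->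
  f (s *: delta_mx 0 i + P) = f P + c * s.
Proof.
(* A negative step is a positive one run backwards from the endpoint. *)
move=> Hf; wlog s0 : s P / 0 < s => [H|] JP JQ.
  have [s0|s0|<-] := ltgtP 0 s; [exact: H| |by rewrite scale0r add0r mulr0 addr0].
  have E : - s *: delta_mx 0 i + (s *: delta_mx 0 i + P) = P.
    by rewrite addrA -scalerDl addNr scale0r add0r.
  have := H (- s) (s *: delta_mx 0 i + P).
  rewrite E oppr_gt0 => /(_ s0 JQ JP) ->.
  by rewrite mulrN subrK.
have [|r _ E] := @MVT_line R _ f (fun _ => c) P (delta_mx 0 i) s s0.
  by move=> r rs; apply/Hf/(slab_line (ltW s0)).
by rewrite -[_ * s]E [RHS]addrC subrK.
Qed.

(** Walk from [P] to [Q] along the axes, first coordinate first: after that step [tc] has its final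
    value, so the later steps cannot leave the slab. *)
Lemma affine_of_cst_derive (f : 'rV[R]_4 -> R) (c : 'I_4 -> R) (P Q : 'rV[R]_4) :
  (forall Q i, slab J Q -> is_derive Q (delta_mx 0 i) f (c i)) ->
  slab J P -> slab J Q ->
  f Q = f P + \sum_i c i * (Q 0 i - P 0 i).
Proof.
move=> Hf JP JQ.
pose P1 := (Q 0 (inord 0) - P 0 (inord 0)) *: delta_mx 0 (inord 0) + P.
pose P2 := (Q 0 (inord 1) - P 0 (inord 1)) *: delta_mx 0 (inord 1) + P1.
pose P3 := (Q 0 (inord 2) - P 0 (inord 2)) *: delta_mx 0 (inord 2) + P2.
have EQ : Q = (Q 0 (inord 3) - P 0 (inord 3)) *: delta_mx 0 (inord 3) + P3.
  by apply/rowP; apply: ord4P; rewrite !mxE ?inord4_eq //= ?eqxx; ring.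
have J1 : slab J P1 by rewrite /slab /= tc_line eqxx mulr1 subrK.
have J2 : slab J P2 by rewrite /slab /= tc_line inord4_eq //= mulr0 add0r.
have J3 : slab J P3 by rewrite /slab /= tc_line inord4_eq //= mulr0 add0r.
rewrite {1}EQ (cst_derive_step (fun Q => Hf Q (inord 3))) -?EQ //.
rewrite (cst_derive_step (fun Q => Hf Q (inord 2))) //.
rewrite (cst_derive_step (fun Q => Hf Q (inord 1))) //.
rewrite (cst_derive_step (fun Q => Hf Q (inord 0))) //.
by rewrite sum4E; ring.
Qed.

End Slab.

(** * The reduced conformal Killing equations *)

(** Every weight in the reduced equations is the exponential of a linear form in t and x, a family
    closed under products. The lock keeps unification from unfolding it. *)
HB.lock Definition expw (R : realType) (a c : R) (P : 'rV[R]_4) : R :=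
  expR (a * tc P + c * xc P).

Lemma expw_gt0 (R : realType) (a c : R) P : 0 < expw a c P.
Proof. by rewrite expw.unlock expR_gt0. Qed.

Lemma expwD (R : realType) (a c a' c' : R) P :
  expw a c P * expw a' c' P = expw (a + a') (c + c') P.
Proof. by rewrite !expw.unlock -expRD; congr expR; ring. Qed.

(** * Derivation rules and tactics for differentiating equations between fields *)

Section DeriveRules.
Variables (R : realType) (V : normedModType R) (P v : V).
Implicit Types (f g : V -> R).

Lemma is_derive_add f g df dg : is_derive P v f df -> is_derive P v g dg ->
  is_derive P v (fun Q => f Q + g Q) (df + dg).
Proof. exact: is_deriveD. Qed.

Lemma is_derive_opp f df : is_derive P v f df ->
  is_derive P v (fun Q => - f Q) (- df).
Proof. exact: is_deriveN. Qed.

Lemma is_derive_mul f g df dg : is_derive P v f df -> is_derive P v g dg ->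
  is_derive P v (fun Q => f Q * g Q) (f P * dg + g P * df).
Proof. exact: is_deriveM. Qed.

Lemma is_derive_const (a : R) : is_derive P v (fun _ => a) 0.
Proof. exact: is_derive_cst. Qed.

Lemma is_derive_scale (a : R) f df : is_derive P v f df ->
  is_derive P v (fun Q => a * f Q) (a * df).
Proof. exact: is_deriveZ. Qed.

End DeriveRules.

(** The weight stays an overall factor, ready to be cancelled after differentiation; the [match] is
    the derivative of its exponent. *)
Lemma is_derive_expw (R : realType) (a c : R) (P : 'rV[R]_4) (i : nat)
    (f : 'rV[R]_4 -> R) (df : R) :
  (i < 4)%N -> is_derive P (delta_mx 0 (inord i)) f df ->
  is_derive P (delta_mx 0 (inord i)) (fun Q => expw a c Q * f Q)
    (expw a c P * (df + match i with 0 => a | 1 => c | _ => 0 end * f P)).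
Proof.
move=> i4 Hf.
have L : is_derive P (delta_mx 0 (inord i)) (fun Q => a * tc Q + c * xc Q)
    (a * (0 == i)%:R + c * (1 == i)%:R).
  rewrite -!(@inord4_eq _ i) //.
  by apply: is_derive_add; apply: is_derive_scale; apply: is_derive_coord.
rewrite !expw.unlock.
apply: is_derive_eq; first exact: is_derive_mul (is_derive_comp1 L (is_derive_expR _)) Hf.
by move: i {i4 Hf L} => [|[|i]] /=; ring.
Qed.

Lemma is_derive_eq_on (R : realType) (n : nat) (M : set 'rV[R]_n.+1)
    (f g : 'rV[R]_n.+1 -> R) (P : 'rV[R]_n.+1) (i : 'I_n.+1) (a b : R) :
  open M -> (forall Q, M Q -> f Q = g Q) -> M P ->
  is_derive P (delta_mx 0 i) f a -> is_derive P (delta_mx 0 i) g b -> a = b.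
Proof. by move=> oM fg MP [_ <-] [_ <-]; exact: (@partial_eq R n M oM f g P i fg MP). Qed.

Ltac partial_tac :=
  first [ eapply smooth_is_derive; [|eassumption]; solve [repeat apply: smooth_partial; assumption]
        | eapply is_derive_add; partial_tac
        | eapply is_derive_opp; partial_tac
        | eapply is_derive_const
        | eapply is_derive_expw; [exact isT|partial_tac]
        | eapply is_derive_scale; partial_tac ].

(** The equation [H] holds on an open set, so it may be differentiated. The two derivatives start as
    existential variables, which [partial_tac] fills in by following the structure of each side. *)
Ltac differentiate H i E :=
  have E := is_derive_eq_on (i := inord i) ltac:(eassumption) H ltac:(eassumption)
     ltac:(partial_tac) ltac:(partial_tac);
  lazy beta iota in E.

(* Derivatives are generalized first because lra compares its atoms up to
   conversion, which unfolds them. *)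
Ltac partial_lra :=
  repeat match goal with
  | |- context [@partial ?R ?n ?i ?f ?P] => generalize (@partial R n i f P)
  | |- context [@expw ?R ?a ?c ?P] => generalize (@expw R a c P)
  end;
  repeat match goal with
  | H : ?x = ?y |- _ =>
    match constr:(x = y) with context [@partial] => clear H end
  end; intros; lra.

(* G and b are the logarithmic derivatives of Gam and B; the weights are
   k = e^{2x} / Gam^2, l = 1 / B^2 and h = Gam^2 / (e^{2x} B^2). Their exponents
   are variables so that unification does not compute with them. *)
Section System.
Variables (R : realType) (G b : R) (M : set 'rV[R]_4).
Variables (T X W Z : 'rV[R]_4 -> R).
Hypothesis M_open : open M.
Hypotheses (sT : smooth M T) (sX : smooth M X) (sW : smooth M W) (sZ : smooth M Z).
Hypotheses (b0 : b != 0) (Gb0 : 1 + G * (b - G) != 0).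

Local Notation Dt := (partial (inord 0)).
Local Notation Dx := (partial (inord 1)).
Local Notation Dy := (partial (inord 2)).
Local Notation Dz := (partial (inord 3)).
Variables (ka kc la lc ha hc : R).
Hypotheses (kaE : ka = - 2 * G) (kcE : kc = 2) (laE : la = - 2 * b) (lcE : lc = 0).
Hypotheses (haE : ha = 2 * G - 2 * b) (hcE : hc = - 2).
Local Notation k := (expw ka kc).
Local Notation l := (expw la lc).
Local Notation h := (expw ha hc).

(** [Xx], [Zz] and [Wy] are differences of diagonal Killing equations, which eliminates the
    conformal factor and A; the other six are the off-diagonal equations. *)
Hypothesis Tz : forall P, M P -> Dz T P = k P * Dt Z P.
Hypothesis Xz : forall P, M P -> Dz X P = - (k P * Dx Z P).
Hypothesis Wz : forall P, M P -> Dz W P = - (l P * Dy Z P).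
Hypothesis Wt : forall P, M P -> Dt W P = h P * Dy T P.
Hypothesis Wx : forall P, M P -> Dx W P = - (h P * Dy X P).
Hypothesis Xx : forall P, M P -> Dx X P = Dt T P.
Hypothesis Xt : forall P, M P -> Dt X P = Dx T P.
Hypothesis Zz : forall P, M P -> Dz Z P = G * T P - X P + Dt T P.
Hypothesis Wy : forall P, M P -> Dy W P = Dz Z P - b * T P.

Let lE P : l P = h P * k P.
Proof. by rewrite [RHS]expwD laE lcE haE hcE kaE kcE; congr (expw _ _ _); ring. Qed.

Let comm f P i j : smooth M f -> M P ->
  partial i (partial j f) P = partial j (partial i f) P.
Proof. exact: partial_comm. Qed.

Let expw_neq0 a c P : expw a c P != 0 :> R.
Proof. exact/lt0r_neq0/expw_gt0. Qed.

(** Compare two values of Dt Dz W. [Wz] gives - l (Dt Dy Z - 2 b Dy Z), while [Wt], [Tz] and l = h k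
    give l Dt Dy Z. *)
Lemma Dt_Dy_Z P : M P -> Dt (Dy Z) P = b * Dy Z P.
Proof.
move=> MP.
differentiate Tz 2%N E1; differentiate Wt 3%N E2; differentiate Wz 0%N E3.
rewrite (comm _ _ sW MP) (comm _ _ sT MP) E1 E3 lE in E2.
rewrite (comm (inord 2) (inord 0) sZ MP) in E2.
apply: (mulfI (expw_neq0 la lc P)); move: E2; rewrite lE laE; partial_lra.
Qed.

(** The same comparison for Dx Dz W: l does not depend on x, and the two values come out
    opposite. *)
Lemma Dy_Dx_Z P : M P -> Dy (Dx Z) P = 0.
Proof.
move=> MP.
differentiate Xz 2%N E1; differentiate Wx 3%N E2; differentiate Wz 1%N E3.
rewrite (comm _ _ sW MP) (comm _ _ sX MP) E1 E3 lE in E2.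
rewrite (comm (inord 1) (inord 2) sZ MP) in E2.
apply: (mulfI (expw_neq0 la lc P)); move: E2; rewrite lE lcE; partial_lra.
Qed.

(* From here on the idea is always to differentiate two of the equations so as to
   reach the same mixed derivative of T, X or W. *)
Lemma Dt_Dx_Z P : M P -> Dt (Dx Z) P = G * Dx Z P - Dt Z P.
Proof.
move=> MP.
differentiate Xt 3%N E1; differentiate Xz 0%N E2; differentiate Tz 1%N E3.
rewrite (comm _ _ sX MP) (comm _ _ sT MP) E2 E3 in E1.
apply: (mulfI (expw_neq0 ka kc P)); move: E1.
rewrite (comm (inord 1) (inord 0) sZ MP) kaE kcE; partial_lra.
Qed.

(** Since Dy Dx Z = 0, the y-derivative of [Dt_Dx_Z] leaves Dy Dt Z = 0, which [Dt_Dy_Z] equates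
    with b Dy Z. *)
Lemma Dy_Z P : M P -> Dy Z P = 0.
Proof.
move=> MP.
differentiate Dt_Dx_Z 2%N E1; differentiate Dy_Dx_Z 0%N E2.
have C := comm (inord 2) (inord 0) (smooth_partial (inord 1) sZ) MP.
have E3 := Dy_Dx_Z MP; have E4 := Dt_Dy_Z MP.
rewrite (comm (inord 0) (inord 2) sZ MP) in E4.
apply: (mulfI b0); rewrite mulr0 -E4; move: E1; rewrite C E2 E3; partial_lra.
Qed.

(** Dy Dz W vanishes by [Wz] because Dy Z = 0; [Wy] gives its other expression. *)
Lemma Dz_Dz_Z P : M P -> Dz (Dz Z) P = b * (k P * Dt Z P).
Proof.
move=> MP.
differentiate Wy 3%N E1; differentiate Wz 2%N E2; differentiate Dy_Z 2%N E3.
move: E1; rewrite (comm _ _ sW MP) E2 E3 (Tz MP); partial_lra.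
Qed.

Lemma Dt_Dt_Z P : M P -> Dt (Dt Z) P = (G + b) * Dt Z P - Dx Z P.
Proof.
move=> MP.
differentiate Zz 3%N E1; differentiate Tz 0%N E2.
apply: (mulfI (expw_neq0 ka kc P)).
move: E1; rewrite (Dz_Dz_Z MP) (Tz MP) (Xz MP) (comm _ _ sT MP) E2 kaE; partial_lra.
Qed.

Lemma Dx_Dx_Z P : M P -> Dx (Dx Z) P = (G - b) * Dt Z P - Dx Z P.
Proof.
move=> MP.
differentiate Xx 3%N E1; differentiate Xz 1%N E2; differentiate Tz 0%N E3.
apply: (mulfI (expw_neq0 ka kc P)).
move: E1; rewrite (comm _ _ sX MP) E2 (comm _ _ sT MP) E3 (Dt_Dt_Z MP) kaE kcE; partial_lra.
Qed.

Lemma Dx_Dt_Z P : M P -> Dx (Dt Z) P = G * Dx Z P - Dt Z P.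
Proof. by move=> MP; rewrite comm // Dt_Dx_Z. Qed.

(** The second t and x derivatives of Z are now linear in Dt Z and Dx Z. Equating the two orders of
    Dx Dt Dt Z and of Dt Dx Dx Z gives, after division by b, a homogeneous linear system whose
    determinant is 1 + G (b - G) up to sign. *)
Lemma DtDx_Z P : M P -> Dt Z P = 0 /\ Dx Z P = 0.
Proof.
move=> MP.
differentiate Dt_Dt_Z 1%N E1; differentiate Dx_Dt_Z 0%N E2.
differentiate Dx_Dx_Z 0%N E3; differentiate Dt_Dx_Z 1%N E4.
have C1 := comm (inord 1) (inord 0) (smooth_partial (inord 0) sZ) MP.
have C2 := comm (inord 1) (inord 0) (smooth_partial (inord 1) sZ) MP.
have [F1 F2] := (Dt_Dt_Z MP, Dx_Dx_Z MP).
have [F3 F4] := (Dt_Dx_Z MP, Dx_Dt_Z MP).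
have I1 : Dt Z P = - G * Dx Z P.
  apply: (mulfI b0); move: E1; rewrite C1 E2 F1 F2 F3 F4; partial_lra.
have I2 : (b - G) * Dt Z P = Dx Z P.
  apply: (mulfI b0); move: E4; rewrite C2 E3 F1 F2 F3 F4; partial_lra.
have x0 : Dx Z P = 0 by apply: (mulfI Gb0); move: I2; rewrite I1; partial_lra.
by split; first (rewrite I1 x0; exact: mulr0).
Qed.

Let Dt_Z P (MP : M P) : Dt Z P = 0 := (DtDx_Z MP).1.
Let Dx_Z P (MP : M P) : Dx Z P = 0 := (DtDx_Z MP).2.

(** Here the study of T and X begins, Z being a function of z alone. Dt Dy W is read from [Wt] and
    from [Wy], where Dt Dz Z = 0. *)
Lemma Dy_Dy_T P : M P -> Dy (Dy T) P = - b * (expw (- ha) (- hc) P * Dt T P).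
Proof.
move=> MP.
differentiate Wt 2%N E1; differentiate Wy 0%N E2; differentiate Dt_Z 3%N E3.
apply: (mulfI (expw_neq0 ha hc P)).
rewrite mulrCA [h P * (_ * _)]mulrA expwD.
have -> : expw (ha - ha) (hc - hc) P = 1.
  by rewrite expw.unlock -[RHS]expR0; congr expR; ring.
move: E1; rewrite (comm _ _ sW MP) E2 (comm _ _ sZ MP) E3; partial_lra.
Qed.

Lemma Dy_Dy_X P : M P -> Dy (Dy X) P = b * (expw (- ha) (- hc) P * Dx T P).
Proof.
move=> MP.
differentiate Wx 2%N E1; differentiate Wy 1%N E2; differentiate Dx_Z 3%N E3.
apply: (mulfI (expw_neq0 ha hc P)).
rewrite mulrCA [h P * (_ * _)]mulrA expwD.
have -> : expw (ha - ha) (hc - hc) P = 1.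
  by rewrite expw.unlock -[RHS]expR0; congr expR; ring.
move: E1; rewrite (comm _ _ sW MP) E2 (comm _ _ sZ MP) E3; partial_lra.
Qed.

Lemma Dt_Dt_T P : M P -> Dt (Dt T) P = Dx T P - G * Dt T P.
Proof.
move=> MP; differentiate Zz 0%N E1; differentiate Dt_Z 3%N E2.
move: E1; rewrite (comm _ _ sZ MP) E2 (Xt MP); partial_lra.
Qed.

(** [Xx] and [Xt] are Cauchy-Riemann equations of hyperbolic type, so T solves the wave equation in
    t and x. *)
Lemma Dx_Dx_T P : M P -> Dx (Dx T) P = Dx T P - G * Dt T P.
Proof.
move=> MP; differentiate Xt 1%N E1; differentiate Xx 0%N E2.
rewrite -(Dt_Dt_T MP); move: E1; rewrite (comm _ _ sX MP) E2; partial_lra.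
Qed.

Lemma Dy_T_X P : M P -> G * Dy T P - Dy X P + Dy (Dt T) P = 0.
Proof.
move=> MP; differentiate Zz 2%N E1; differentiate Dy_Z 3%N E2.
move: E1; rewrite (comm _ _ sZ MP) E2; partial_lra.
Qed.

Lemma Dx_Dy_X P : M P -> Dx (Dy X) P = Dy (Dt T) P.
Proof. by move=> MP; differentiate Xx 2%N E1; rewrite -E1; exact: (comm _ _ sX MP). Qed.

Lemma Dt_Dy_T P : M P -> Dt (Dy T) P = Dy (Dt T) P.
Proof. by move=> MP; exact: (comm _ _ sT MP). Qed.

(** Dx Dy Dy X and Dt Dy Dy T both equal Dy Dy Dt T, which yields [J2]; the y-derivative of [Dy_T_X]
    yields [J3]. Then [J2] minus twice [J3] is - b Dt T = 0. *)
Lemma DtDx_T P : M P -> Dt T P = 0 /\ Dx T P = 0.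
Proof.
move=> MP.
differentiate Dy_Dy_X 1%N E1; differentiate Dy_Dy_T 0%N E2.
differentiate Dx_Dy_X 2%N E3; differentiate Dt_Dy_T 2%N E4.
differentiate Dy_T_X 2%N E5.
have C1 := comm (inord 1) (inord 2) (smooth_partial (inord 2) sX) MP.
have C2 := comm (inord 0) (inord 2) (smooth_partial (inord 2) sT) MP.
have {C1 E3} S1 := etrans (esym E1) (etrans C1 E3).
have {C2 E4} S2 := etrans (esym E2) (etrans C2 E4).
rewrite (Dx_Dx_T MP) in S1; rewrite (Dt_Dt_T MP) in S2.
rewrite (Dy_Dy_T MP) (Dy_Dy_X MP) in E5.
have H0 := expw_neq0 (- ha) (- hc) P.
have J2 : 2 * Dx T P + (b - 2 * G) * Dt T P = 0.
  apply: (mulfI b0); apply: (mulfI H0); move: (etrans S1 (esym S2)).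
  move: (expw (- ha) (- hc) P) => H; rewrite haE hcE; partial_lra.
have J3 : Dx T P + (b - G) * Dt T P = 0.
  apply: (mulfI b0); apply: (mulfI H0); move: E5; rewrite -S2.
  move: (expw (- ha) (- hc) P) => H; rewrite haE; partial_lra.
have T0 : Dt T P = 0 by apply: (mulfI b0); move: J2 J3; partial_lra.
split; first exact: T0.
by move: J3; rewrite T0; partial_lra.
Qed.

Let Dt_T P (MP : M P) : Dt T P = 0 := (DtDx_T MP).1.
Let Dx_T P (MP : M P) : Dx T P = 0 := (DtDx_T MP).2.

(** With Dt T = 0, [Dy_T_X] says Dy X = G Dy T. The two orders of Dt Dx W then give (1 + G (b - G))
    Dy T = 0. *)
Lemma DyTX P : M P -> Dy T P = 0 /\ Dy X P = 0.
Proof.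
move=> MP.
differentiate Wt 1%N E1; differentiate Wx 0%N E2.
differentiate Dx_T 2%N E3; differentiate Dt_T 2%N E4.
have E5 := Dy_T_X MP; rewrite E4 addr0 in E5.
have E6 : Dt X P = 0 := etrans (Xt MP) (Dx_T MP).
have E7 : Dt (Dy X) P = 0.
  rewrite (comm _ _ sX MP); differentiate Xt 2%N E8; rewrite E8; exact: E3.
have XG : Dy X P = G * Dy T P by move: E5; partial_lra.
have T0 : Dy T P = 0.
  apply: (mulfI Gb0); apply: (mulfI (expw_neq0 ha hc P)).
  move: E1; rewrite (comm _ _ sW MP) E2 E7 (comm (inord 1) _ sT MP) E3 XG.
  move: (expw ha hc P) => H; rewrite haE hcE; partial_lra.
by split; [exact: T0|rewrite XG T0; exact: mulr0].
Qed.

Lemma Dt_W P : M P -> Dt W P = 0.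
Proof. by move=> MP; rewrite (Wt MP) (DyTX MP).1 mulr0. Qed.

Lemma Dx_W P : M P -> Dx W P = 0.
Proof. by move=> MP; rewrite (Wx MP) (DyTX MP).2 mulr0 oppr0. Qed.

Lemma system_partials P : M P ->
  [/\ [/\ Dt T P = 0, Dx T P = 0, Dy T P = 0 & Dz T P = 0],
      [/\ Dt X P = 0, Dx X P = 0, Dy X P = 0 & Dz X P = 0],
      [/\ Dt W P = 0, Dx W P = 0, Dy W P = G * T P - X P - b * T P & Dz W P = 0] &
      [/\ Dt Z P = 0, Dx Z P = 0, Dy Z P = 0 & Dz Z P = G * T P - X P]].
Proof.
move=> MP; have [Ty Xy] := DyTX MP.
have [Zt Zx] := DtDx_Z MP; have [Tt Tx] := DtDx_T MP.
have Zy := Dy_Z MP.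
have Zz0 : Dz Z P = G * T P - X P by rewrite (Zz MP) Tt addr0.
rewrite (Tz MP) (Xz MP) (Wz MP) (Xt MP) (Xx MP) (Dt_W MP) (Dx_W MP) (Wy MP).
rewrite Tt Tx Ty Xy Zt Zx Zy Zz0 !mulr0 oppr0.
by split; split; reflexivity.
Qed.

End System.

(** * Conformal Killing fields of the Bianchi V metric *)

Lemma derive_eq_cst_line (R : realType) (f : 'rV[R]_4 -> R) (P : 'rV[R]_4) i :
  (forall s, f (s *: delta_mx 0 i + P) = f P) -> partial i f P = 0.
Proof. by move=> /is_derive_cst_line[]. Qed.

Lemma partial_cst (R : realType) (n : nat) (a : R) (P : 'rV[R]_n.+1) i :
  partial i (fun _ => a) P = 0.
Proof. exact: derive_cst. Qed.

(* Every component of the diagonal Bianchi V metric is of this form. *)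
Definition warp (R : realType) (f : R -> R) (c : R) (P : 'rV[R]_4) : R :=
  f (tc P) * expR (c * xc P).

Lemma warp_neq0 (R : realType) (f : R -> R) (c : R) (P : 'rV[R]_4) :
  f (tc P) != 0 -> warp f c P != 0.
Proof. by move=> f0; rewrite mulf_neq0 // gt_eqF // expR_gt0. Qed.

Lemma partial_warp (R : realType) (f : R -> R) (c df : R) (P : 'rV[R]_4) i :
  is_derive (tc P) 1 f df ->
  partial i (warp f c) P =
  ((inord 0 == i)%:R * df + (inord 1 == i)%:R * c * f (tc P)) * expR (c * xc P).
Proof.
move=> Hf.
have D1 := is_derive_comp1 (is_derive_coord (inord 0) i P) Hf.
have D2 := is_derive_comp1
  (is_derive_scale c (is_derive_coord (inord 1) i P)) (is_derive_expR _).
have [_] := is_derive_mul D1 D2.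
rewrite /partial => ->; rewrite -/(tc P) -/(xc P).
move: (expR _) (_ == i) (_ == i) => E e1 e2; ring.
Qed.

Lemma lie_diag (R : realType) (n : nat) (Y : 'rV[R]_n.+1 -> 'rV[R]_n.+1)
    (w : 'I_n.+1 -> 'rV[R]_n.+1 -> R) (P : 'rV[R]_n.+1) a b :
  lie_metric Y (fun Q => diag_mx (\row_c w c Q)) P a b =
  (\sum_c Y P 0 c * partial c (w a) P) *+ (a == b)
  + w b P * partial a (fun Q => Y Q 0 b) P
  + w a P * partial b (fun Q => Y Q 0 a) P.
Proof.
rewrite mxE; congr (_ + _ + _).
- have [<-|ab] := eqVneq a b.
    rewrite mulr1n; apply: eq_bigr => c _; congr (_ * partial c _ P).
    by apply/funext => Q; rewrite !mxE eqxx mulr1n.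
  rewrite mulr0n big1 // => c _.
  rewrite [X in partial c X](_ : _ = fun=> 0) ?partial_cst ?mulr0 //.
  by apply/funext => Q; rewrite !mxE (negPf ab) mulr0n.
- rewrite (bigD1 b) //= big1 ?addr0 => [|c cb]; first by rewrite !mxE eqxx mulr1n.
  by rewrite !mxE (negPf cb) mulr0n mul0r.
- rewrite (bigD1 a) //= big1 ?addr0 => [|c ca]; first by rewrite !mxE eqxx mulr1n.
  by rewrite !mxE eq_sym (negPf ca) mulr0n mul0r.
Qed.

Definition jac (R : realType) (Y : 'rV[R]_4 -> 'rV[R]_4) (P : 'rV[R]_4)
    (i j : 'I_4) : R :=
  partial i (fun Q => Y Q 0 j) P.

Lemma lie_warp (R : realType) (F : 'I_4 -> R -> R) (c dF : 'I_4 -> R)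
    (Y : 'rV[R]_4 -> 'rV[R]_4) (P : 'rV[R]_4) i j :
  (forall a, is_derive (tc P) 1 (F a) (dF a)) ->
  lie_metric Y (fun Q => diag_mx (\row_a warp (F a) (c a) Q)) P i j =
  ((tc (Y P) * dF i + c i * xc (Y P) * F i (tc P)) * expR (c i * xc P)) *+ (i == j)
  + F j (tc P) * expR (c j * xc P) * jac Y P i j
  + F i (tc P) * expR (c i * xc P) * jac Y P j i.
Proof.
move=> HF; rewrite lie_diag sum4E -!/(jac _ _ _ _) /warp -/(warp _ _).
congr (_ *+ _ + _ + _).
rewrite !(partial_warp _ _ (HF i)) !inord4_eq //.
rewrite -/(tc (Y P)) -/(xc (Y P)).
by move: (expR _) (tc (Y P)) (xc (Y P)) (F i _) => E t0 x0 f /=; ring.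
Qed.

(** The exponential cancels from each diagonal equation, but an off-diagonal one involves two
    different metric coefficients and keeps both. *)
Definition warp_eqs (R : realType) (f dF c : 'I_4 -> R) (x t0 x0 : R)
    (D : 'I_4 -> 'I_4 -> R) (phi : R) : Prop :=
  (forall i, t0 * dF i + c i * x0 * f i + 2 * f i * D i i = 2 * phi * f i) /\
  (forall i j, i != j ->
     f j * expR (c j * x) * D i j + f i * expR (c i * x) * D j i = 0).

Lemma warp_eqsP (R : realType) (F : 'I_4 -> R -> R) (c dF : 'I_4 -> R)
    (Y : 'rV[R]_4 -> 'rV[R]_4) (P : 'rV[R]_4) (phi : R)
    (g := fun Q => diag_mx (\row_a warp (F a) (c a) Q)) :
  (forall a, is_derive (tc P) 1 (F a) (dF a)) ->
  lie_metric Y g P = (2 * phi) *: g P <->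
  warp_eqs (fun i => F i (tc P)) dF c (xc P) (tc (Y P)) (xc (Y P)) (jac Y P) phi.
Proof.
move=> HF.
have E i j : ((2 * phi) *: g P) i j =
    (2 * phi * F i (tc P) * expR (c i * xc P)) *+ (i == j).
  rewrite /g !mxE /warp; case: (i == j); last by rewrite !mulr0n mulr0.
  by rewrite !mulr1n mulrA.
have L i j := lie_warp c Y i j HF; rewrite -/g in L.
have ex i : expR (c i * xc P) != 0 by rewrite gt_eqF // expR_gt0.
move: (jac Y P) (tc (Y P)) (xc (Y P)) L E => D t0 x0 L E.
rewrite /warp_eqs /=; split.
  move=> /matrixP H; split=> [i|i j ij].
    apply: (mulIf (ex i)); move: (H i i); rewrite L E eqxx !mulr1n => <-.
    by move: (expR _) => e; ring.
  by move: (H i j); rewrite L E (negPf ij) !mulr0n add0r.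
move=> [H1 H2]; apply/matrixP => i j; rewrite L E.
have [<-|ij] := eqVneq i j; last by rewrite !mulr0n add0r H2.
rewrite !mulr1n -H1; move: (expR _) => e; ring.
Qed.

Section BianchiV.
Variables (R : realType) (A Gam B : R -> R).

Definition bianchi_fun (a : 'I_4) : R -> R :=
  nth (fun=> 0) [:: (fun t => - (A t * Gam t) ^+ 2); (fun t => (A t * Gam t) ^+ 2);
                    (fun t => (A t * B t) ^+ 2); (fun t => A t ^+ 2)] a.

Definition bianchi_exp (a : 'I_4) : R := [:: 0; 0; 2; 2]`_a.

Lemma bianchiV_diag :
  bianchiV A Gam B =
  fun P => diag_mx (\row_a warp (bianchi_fun a) (bianchi_exp a) P).
Proof.
apply/funext => P; apply/matrixP => i j; rewrite !mxE /warp.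
case: (i == j); rewrite ?mulr0n ?mulr0 // !mulr1n.
rewrite /bianchi_fun /bianchi_exp.
case: i => [[|[|[|[|//]]]] Hi] /=; rewrite ?mul0r ?expR0 ?mulr1; ring.
Qed.

Lemma bianchi_funE :
  (bianchi_fun (inord 0) = fun t => - (A t * Gam t) ^+ 2) *
  (bianchi_fun (inord 1) = fun t => (A t * Gam t) ^+ 2) *
  (bianchi_fun (inord 2) = fun t => (A t * B t) ^+ 2) *
  (bianchi_fun (inord 3) = fun t => A t ^+ 2).
Proof. by rewrite /bianchi_fun !inordK. Qed.

Lemma bianchi_expE :
  (bianchi_exp (inord 0) = 0) * (bianchi_exp (inord 1) = 0) *
  (bianchi_exp (inord 2) = 2) * (bianchi_exp (inord 3) = 2).
Proof. by rewrite /bianchi_exp !inordK. Qed.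

(* a, g and b stand for the logarithmic derivatives of A, Gam and B at the
   point, and D i j for the derivative in direction i of the j-th component of
   the field, whose first two components are t0 and x0. *)
Definition conformal_eqs (a g b E t0 x0 : R) (D : nat -> nat -> R) (phi t : R) : Prop :=
  [/\ [/\ t0 * (a + g) + D 0%N 0%N = phi, t0 * (a + g) + D 1%N 1%N = phi,
          t0 * (a + b) + x0 + D 2%N 2%N = phi & t0 * a + x0 + D 3%N 3%N = phi],
      D 0%N 1%N = D 1%N 0%N,
      Gam t ^+ 2 * D 2%N 0%N = E * B t ^+ 2 * D 0%N 2%N /\
      Gam t ^+ 2 * D 2%N 1%N = - (E * B t ^+ 2 * D 1%N 2%N),
      Gam t ^+ 2 * D 3%N 0%N = E * D 0%N 3%N /\
      Gam t ^+ 2 * D 3%N 1%N = - (E * D 1%N 3%N) &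
      B t ^+ 2 * D 3%N 2%N = - D 2%N 3%N].

Lemma is_derive_sqr (f : R -> R) (t df : R) :
  is_derive t 1 f df -> is_derive t 1 (fun s => f s ^+ 2) (2 * f t * df).
Proof.
move=> Hf; rewrite (_ : (fun _ => _) = (fun s => f s * f s)); last first.
  by apply/funext => s; rewrite expr2.
by apply: (is_derive_eq (is_derive_mul Hf Hf)); ring.
Qed.

(** Dividing each diagonal equation by twice its metric coefficient leaves logarithmic derivatives,
    and A^2 cancels from the off-diagonal equations. *)
Lemma conformal_eqsP (a g b : R) (Y : 'rV[R]_4 -> 'rV[R]_4) (phi : R) (P : 'rV[R]_4) :
  A (tc P) != 0 -> Gam (tc P) != 0 -> B (tc P) != 0 ->
  is_derive (tc P) 1 A (a * A (tc P)) ->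
  is_derive (tc P) 1 Gam (g * Gam (tc P)) ->
  is_derive (tc P) 1 B (b * B (tc P)) ->
  lie_metric Y (bianchiV A Gam B) P = (2 * phi) *: bianchiV A Gam B P <->
  conformal_eqs a g b (expR (2 * xc P)) (tc (Y P)) (xc (Y P))
    (fun i j => jac Y P (inord i) (inord j)) phi (tc P).
Proof.
move=> A0 G0 B0 dA dG dB.
have dAG := is_derive_sqr (is_derive_mul dA dG).
have dAB := is_derive_sqr (is_derive_mul dA dB).
pose dF (i : 'I_4) : R :=
  [:: - (2 * (a + g) * (A (tc P) * Gam (tc P)) ^+ 2);
      2 * (a + g) * (A (tc P) * Gam (tc P)) ^+ 2;
      2 * (a + b) * (A (tc P) * B (tc P)) ^+ 2; 2 * a * A (tc P) ^+ 2]`_i.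
have HF i : is_derive (tc P) 1 (bianchi_fun i) (dF i).
  move: i; apply: ord4P; rewrite /dF bianchi_funE inordK //=.
  - by apply: (is_derive_eq (is_derive_opp dAG)); ring.
  - by apply: (is_derive_eq dAG); ring.
  - by apply: (is_derive_eq dAB); ring.
  - by apply: (is_derive_eq (is_derive_sqr dA)); ring.
rewrite bianchiV_diag; apply: (iff_trans (warp_eqsP bianchi_exp Y phi HF)).
have dFE : (dF (inord 0) = - (2 * (a + g) * (A (tc P) * Gam (tc P)) ^+ 2)) *
  (dF (inord 1) = 2 * (a + g) * (A (tc P) * Gam (tc P)) ^+ 2) *
  (dF (inord 2) = 2 * (a + b) * (A (tc P) * B (tc P)) ^+ 2) *
  (dF (inord 3) = 2 * a * A (tc P) ^+ 2) by rewrite /dF !inordK.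
move: (tc (Y P)) (xc (Y P)) (jac Y P) => t0 x0 D.
have E0 : expR (2 * xc P) != 0 by rewrite gt_eqF // expR_gt0.
have e1 : expR (0 * xc P) = 1 by rewrite mul0r expR0.
have H2 : 2 != 0 :> R by [].
rewrite /warp_eqs /conformal_eqs.
clear HF; move: dFE; move: dF => dF dFE.
split.
  move=> [H1 HO]; move: (H1 (inord 0)) (H1 (inord 1)) (H1 (inord 2)) (H1 (inord 3)).
  have o i j : (i < 4)%N -> (j < 4)%N -> i != j -> _ := fun i4 j4 ij =>
    HO (inord i) (inord j) (etrans (congr1 negb (inord4_eq i4 j4)) ij).
  move: (o 0%N 1%N isT isT isT) (o 0%N 2%N isT isT isT) (o 0%N 3%N isT isT isT).
  move: (o 1%N 2%N isT isT isT) (o 1%N 3%N isT isT isT) (o 2%N 3%N isT isT isT).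
  rewrite !bianchi_funE !bianchi_expE !dFE e1.
  move: (expR _) E0 (Gam _) (B _) (A _) G0 B0 A0 => E E0 G b' a' G0 B0 A0.
  have A2 : a' ^+ 2 != 0 by rewrite expf_neq0.
  have AG2 : 2 * (a' * G) ^+ 2 != 0 by rewrite mulf_neq0 // expf_neq0 // mulf_neq0.
  have AB2 : 2 * (a' * b') ^+ 2 != 0 by rewrite mulf_neq0 // expf_neq0 // mulf_neq0.
  have AA2 : 2 * a' ^+ 2 != 0 by rewrite mulf_neq0.
  have AE : a' ^+ 2 * E != 0 by rewrite mulf_neq0.
  move=> h23 h13 h12 h03 h02 h01 h0 h1 h2 h3.
  split; first split.
  - by apply: (mulfI AG2); lra.
  - by apply: (mulfI AG2); lra.
  - by apply: (mulfI AB2); lra.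
  - by apply: (mulfI AA2); lra.
  - by apply: (mulfI AG2); lra.
  - by split; apply: (mulfI A2); lra.
  - by split; apply: (mulfI A2); lra.
  - by apply: (mulfI AE); lra.
move=> [[h0 h1 h2 h3] h01 [h02 h12] [h03 h13] h23].
split.
  apply: ord4P; rewrite !bianchi_funE !bianchi_expE !dFE.
  - by rewrite -h0; ring.
  - by rewrite -h1; ring.
  - by rewrite -h2; ring.
  - by rewrite -h3; ring.
set f := fun i j => bianchi_fun j (tc P) * expR (bianchi_exp j * xc P) * D i j +
    bianchi_fun i (tc P) * expR (bianchi_exp i * xc P) * D j i.
have fC i j : f i j = f j i by exact: addrC.
have o01 : f (inord 0) (inord 1) = 0.
  by rewrite /f !bianchi_funE !bianchi_expE e1 h01; ring.
have o02 : f (inord 0) (inord 2) = 0.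
  (* Zero is written as A^2 times the difference of the two sides of [h02], which turns the goal
     into a polynomial identity; the pairs below are treated alike. *)
  rewrite -(mulr0 (A (tc P) ^+ 2)) -(subrr (Gam (tc P) ^+ 2 * D (inord 2) (inord 0))) {1}h02.
  by rewrite /f !bianchi_funE !bianchi_expE e1; ring.
have o03 : f (inord 0) (inord 3) = 0.
  rewrite -(mulr0 (A (tc P) ^+ 2)) -(subrr (Gam (tc P) ^+ 2 * D (inord 3) (inord 0))) {1}h03.
  by rewrite /f !bianchi_funE !bianchi_expE e1; ring.
have o12 : f (inord 1) (inord 2) = 0.
  rewrite -(mulr0 (A (tc P) ^+ 2)) -(subrr (Gam (tc P) ^+ 2 * D (inord 2) (inord 1))) {2}h12.
  by rewrite /f !bianchi_funE !bianchi_expE e1; ring.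
have o13 : f (inord 1) (inord 3) = 0.
  rewrite -(mulr0 (A (tc P) ^+ 2)) -(subrr (Gam (tc P) ^+ 2 * D (inord 3) (inord 1))) {2}h13.
  by rewrite /f !bianchi_funE !bianchi_expE e1; ring.
have o23 : f (inord 2) (inord 3) = 0.
  rewrite -(mulr0 (A (tc P) ^+ 2 * expR (2 * xc P))).
  rewrite -(subrr (B (tc P) ^+ 2 * D (inord 3) (inord 2))) {2}h23.
  by rewrite /f !bianchi_funE !bianchi_expE; ring.
move=> i j ij; change (f i j = 0); move: i j ij.
apply: ord4P; apply: ord4P; rewrite ?eqxx // => _.
- by rewrite fC; exact: o01.
- by rewrite fC; exact: o02.
- by rewrite fC; exact: o12.
- by rewrite fC; exact: o03.
- by rewrite fC; exact: o13.
- by rewrite fC; exact: o23.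
Qed.

End BianchiV.

(** Differentiating f^2 = e^{c t} gives 2 f f' = c f^2; dividing by 2 f avoids any choice of sign
    for f. *)
Lemma is_derive_of_sqr_expR (R : realType) (J : set R) (f : R -> R) (c t : R) :
  open J -> J t -> derivable f t 1 -> f t != 0 ->
  (forall s, J s -> f s ^+ 2 = expR (c * s)) ->
  is_derive t 1 f (c / 2 * f t).
Proof.
move=> oJ Jt df f0 fE; have Hf := derivableP df.
have H1 : is_derive t 1 (fun s => expR (c * s)) (2 * f t * 'D_1 f t).
  apply: near_eq_is_derive (is_derive_sqr Hf).
  by apply: filterS (open_nbhs_nbhs (conj oJ Jt)).
have [_ H2] := is_derive_comp1 (is_derive_scale c (is_derive_id t (1 : R)))
  (is_derive_expR (c * t)).
case: H1 => _; rewrite H2 -fE // => E.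
have ff : 2 * f t != 0 by rewrite mulf_neq0.
apply: (is_derive_eq Hf); apply: (mulfI ff); rewrite -E.
by move: (f t) => y; field.
Qed.

Lemma expw_cancel (R : realType) (a c a' c' x y : R) (P : 'rV[R]_4) :
  expw a c P * x = expw a' c' P * y -> y = expw (a - a') (c - c') P * x.
Proof.
move=> H; apply: (mulfI (lt0r_neq0 (expw_gt0 a' c' P))).
by rewrite -H mulrA expwD !subrKC.
Qed.

(** * Fields with constant t and x components and affine y and z components *)

Definition affine_field (R : realType) (t0 x0 d2 e2 d3 e3 : R) (P : 'rV[R]_4) :
    'rV[R]_4 :=
  row4 t0 x0 (d2 * yc P + e2) (d3 * zc P + e3).

Lemma partial_affine_coord (R : realType) (n : nat) (a c : R) (i j : 'I_n.+1)
    (P : 'rV[R]_n.+1) :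
  partial i (fun Q => a * Q 0 j + c) P = a * (j == i)%:R.
Proof.
have [_] := is_derive_add (is_derive_scale a (is_derive_coord j i P))
  (is_derive_const P (delta_mx 0 i) c).
by rewrite addr0.
Qed.

Section AffineField.
Variables (R : realType) (t0 x0 d2 e2 d3 e3 : R).
Local Notation Y := (affine_field t0 x0 d2 e2 d3 e3).

Lemma affine_fieldE :
  ((fun Q : 'rV[R]_4 => Y Q 0 (inord 0)) = fun=> t0) *
  ((fun Q : 'rV[R]_4 => Y Q 0 (inord 1)) = fun=> x0) *
  ((fun Q : 'rV[R]_4 => Y Q 0 (inord 2)) = fun Q => d2 * Q 0 (inord 2) + e2) *
  ((fun Q : 'rV[R]_4 => Y Q 0 (inord 3)) = fun Q => d3 * Q 0 (inord 3) + e3).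
Proof. by do !split; apply/funext => Q; rewrite row4E. Qed.

Lemma vector_field_affine (M : set 'rV[R]_4) : vector_field M Y.
Proof.
apply: ord4P; rewrite affine_fieldE.
- exact: smooth_cst.
- exact: smooth_cst.
- exact: smooth_affine_coord.
- exact: smooth_affine_coord.
Qed.

Lemma jac_affine P (i j : nat) : (i < 4)%N -> (j < 4)%N ->
  jac Y P (inord i) (inord j) = (if j == 2 then d2 else if j == 3 then d3 else 0)
    * (j == i)%:R.
Proof.
move=> i4; case: j => [|[|[|[|//]]]] _; rewrite /jac affine_fieldE.
- by rewrite partial_cst mul0r.
- by rewrite partial_cst mul0r.
- by rewrite partial_affine_coord inord4_eq.
- by rewrite partial_affine_coord inord4_eq.
Qed.

Lemma conformal_eqs_affine (Gam B : R -> R) (a g b E phi t : R) P :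
  t0 * (a + g) = phi -> t0 * (a + b) + x0 + d2 = phi ->
  t0 * a + x0 + d3 = phi ->
  conformal_eqs Gam B a g b E t0 x0 (fun i j => jac Y P (inord i) (inord j)) phi t.
Proof.
move=> h0 h2 h3; rewrite /conformal_eqs !jac_affine //=.
by rewrite ?(mulr0n, mulr1n, mul0r, mulr0, mulr1, addr0, oppr0).
Qed.

End AffineField.

Lemma affine_of_partials (R : realType) (J : set R) (f : 'rV[R]_4 -> R)
    (c0 c1 c2 c3 : R) (P Q : 'rV[R]_4) :
  is_interval J -> smooth (slab J) f ->
  (forall S, slab J S -> [/\ partial (inord 0) f S = c0, partial (inord 1) f S = c1,
     partial (inord 2) f S = c2 & partial (inord 3) f S = c3]) ->
  slab J P -> slab J Q ->
  f Q = f P + c0 * (tc Q - tc P) + c1 * (xc Q - xc P) + c2 * (yc Q - yc P)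
    + c3 * (zc Q - zc P).
Proof.
move=> iJ sf H JP JQ; pose c (i : 'I_4) : R := [:: c0; c1; c2; c3]`_i.
have Hc S i : slab J S -> is_derive S (delta_mx 0 i) f (c i).
  move=> JS; apply: (is_derive_eq (smooth_is_derive i sf JS)).
  by have [h0 h1 h2 h3] := H S JS; move: i; apply: ord4P; rewrite /c inordK.
by rewrite (affine_of_cst_derive iJ Hc JP JQ) sum4E /c !inordK // !addrA.
Qed.

(** * Conformal Killing fields for the exponential Gam and B *)

Section Uniqueness.
Variables (R : realType) (m lam : R) (J : set R) (A Gam B : R -> R).
Hypotheses (hm : m != 0) (J_open : open J) (J_itv : is_interval J).
Hypotheses (A_der : forall t, J t -> derivable A t 1).
Hypotheses (Gam_der : forall t, J t -> derivable Gam t 1).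
Hypotheses (B_der : forall t, J t -> derivable B t 1).
Hypothesis A_neq0 : forall t, J t -> A t != 0.
Hypothesis Gam_neq0 : forall t, J t -> Gam t != 0.
Hypothesis B_neq0 : forall t, J t -> B t != 0.
Hypothesis GamE : forall t, J t -> Gam t ^+ 2 = expR (m * lam * t).
Hypothesis BE : forall t, J t -> B t ^+ 2 = expR (m * (lam - 1) * t).

Lemma conformal_eqs_expR (Y : 'rV[R]_4 -> 'rV[R]_4) (phi : R) (P : 'rV[R]_4) :
  slab J P ->
  lie_metric Y (bianchiV A Gam B) P = (2 * phi) *: bianchiV A Gam B P <->
  conformal_eqs Gam B (derive1 A (tc P) / A (tc P)) (m * lam / 2)
    (m * (lam - 1) / 2) (expR (2 * xc P)) (tc (Y P)) (xc (Y P))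
    (fun i j => jac Y P (inord i) (inord j)) phi (tc P).
Proof.
move=> JP; have Jt : J (tc P) := JP.
have dA : is_derive (tc P) 1 A (derive1 A (tc P) / A (tc P) * A (tc P)).
  by rewrite divfK ?A_neq0 // derive1E; apply/derivableP/A_der.
exact: (conformal_eqsP Y phi (A_neq0 Jt) (Gam_neq0 Jt) (B_neq0 Jt) dA
  (is_derive_of_sqr_expR J_open Jt (Gam_der Jt) (Gam_neq0 Jt) GamE)
  (is_derive_of_sqr_expR J_open Jt (B_der Jt) (B_neq0 Jt) BE)).
Qed.

(** Here 1 + G (b - G) = (4 - m^2 lam) / 4 and b = m (lam - 1) / 2, so the two exclusions are the
    nondegeneracy conditions of the reduced system. Its solution has constant T and X, and
    integration from a base point gives the affine components. *)
Lemma ckv_affine (Y : 'rV[R]_4 -> 'rV[R]_4) (phi : 'rV[R]_4 -> R)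
    (G := m * lam / 2) (b := m * (lam - 1) / 2) :
  lam != 1 -> m ^+ 2 * lam != 4 ->
  CKV (slab J) (bianchiV A Gam B) Y phi ->
  exists t0 x0 e2 e3, forall P, slab J P ->
    Y P = affine_field t0 x0 (G * t0 - x0 - b * t0) e2 (G * t0 - x0) e3 P.
Proof.
move=> lam1 mlam [Ysm Yck].
have b0 : b != 0 by rewrite !mulf_neq0 ?subr_eq0 ?invr_neq0.
have Gb0 : 1 + G * (b - G) != 0.
  rewrite (_ : 1 + _ = (4 - m ^+ 2 * lam) / 4); last by rewrite /G /b; field.
  by rewrite mulf_neq0 ?invr_neq0 // subr_eq0 eq_sym.
have E P : slab J P -> conformal_eqs Gam B (derive1 A (tc P) / A (tc P)) G b
    (expR (2 * xc P)) (tc (Y P)) (xc (Y P))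
    (fun i j => jac Y P (inord i) (inord j)) (phi P) (tc P).
  by move=> JP; apply/(conformal_eqs_expR Y _ JP)/Yck.
have GE P : slab J P -> Gam (tc P) ^+ 2 = expw (2 * G) 0 P.
  by move=> JP; rewrite GamE // expw.unlock /G; congr expR; field.
have B2 P : slab J P -> B (tc P) ^+ 2 = expw (2 * b) 0 P.
  by move=> JP; rewrite BE // expw.unlock /b; congr expR; field.
have E2 (P : 'rV[R]_4) : expR (2 * xc P) = expw 0 2 P.
  by rewrite expw.unlock mul0r add0r.
have Jo := open_slab J_open.
(* The exponents are given in the unreduced form in which [expw_cancel] returns them. The nine
   equations of the system are then discharged one at a time. *)
have S P (JP : slab J P) := system_partials Jo
  (Ysm (inord 0)) (Ysm (inord 1)) (Ysm (inord 2)) (Ysm (inord 3)) b0 Gb0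
  (_ : 0 - 2 * G = - 2 * G) (_ : 2 - 0 = 2) (_ : 0 - 2 * b = - 2 * b)
  (_ : 0 - 0 = 0) (_ : 2 * G - (0 + 2 * b) = 2 * G - 2 * b)
  (_ : 0 - (2 + 0) = - 2) _ _ _ _ _ _ _ _ _ JP.
have {}S := S ltac:(ring) ltac:(ring) ltac:(ring) ltac:(ring) ltac:(ring) ltac:(ring).
lapply S => [{}S|{S} P JP]; last first.
  have [[h0 h1 h2 h3] h01 [h02 h12] [h03 h13] h23] := E P JP.
  rewrite (GE P JP) E2 in h03; exact: (expw_cancel (esym h03)).
lapply S => [{}S|{S} P JP]; last first.
  have [[h0 h1 h2 h3] h01 [h02 h12] [h03 h13] h23] := E P JP.
  rewrite (GE P JP) E2 -mulrN in h13; rewrite -mulrN; exact: (expw_cancel (esym h13)).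
lapply S => [{}S|{S} P JP]; last first.
  have [[h0 h1 h2 h3] h01 [h02 h12] [h03 h13] h23] := E P JP.
  have e1 : expw 0 0 P = 1 by rewrite expw.unlock !mul0r addr0 expR0.
  have {}h23 : expw 0 0 P * - jac Y P (inord 2) (inord 3) =
      expw (2 * b) 0 P * jac Y P (inord 3) (inord 2).
    by rewrite e1 mul1r -(B2 P JP) h23.
  rewrite -mulrN; exact: (expw_cancel h23).
lapply S => [{}S|{S} P JP]; last first.
  have [[h0 h1 h2 h3] h01 [h02 h12] [h03 h13] h23] := E P JP.
  rewrite (GE P JP) (B2 P JP) E2 expwD in h02; exact: (expw_cancel h02).
lapply S => [{}S|{S} P JP]; last first.
  have [[h0 h1 h2 h3] h01 [h02 h12] [h03 h13] h23] := E P JP.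
  rewrite (GE P JP) (B2 P JP) E2 expwD -mulrN in h12.
  rewrite -[LHS]opprK; congr (- _); exact: (expw_cancel h12).
lapply S => [{}S|{S} P JP]; last first.
  have [[h0 h1 h2 h3] h01 [h02 h12] [h03 h13] h23] := E P JP.
  exact: (addrI _ (etrans h1 (esym h0))).
lapply S => [{}S|{S} P JP]; last first.
  have [[h0 h1 h2 h3] h01 [h02 h12] [h03 h13] h23] := E P JP.
  exact: h01.
lapply S => [{}S|{S} P JP]; last first.
  have [[h0 h1 h2 h3] h01 [h02 h12] [h03 h13] h23] := E P JP.
  move: (etrans h3 (esym h0)) => {h0 h1 h2 h3 h01 h02 h12 h03 h13 h23}.
  rewrite /jac -/(tc (Y P)) -/(xc (Y P)).
  move: (tc (Y P)) (xc (Y P)) (derive1 A (tc P) / A (tc P)) => t0 x0 a.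
  partial_lra.
lapply S => [{}S|{S} P JP]; last first.
  have [[h0 h1 h2 h3] h01 [h02 h12] [h03 h13] h23] := E P JP.
  move: (etrans h2 (esym h3)) => {h0 h1 h2 h3 h01 h02 h12 h03 h13 h23}.
  rewrite /jac -/(tc (Y P)) -/(xc (Y P)).
  move: (tc (Y P)) (xc (Y P)) (derive1 A (tc P) / A (tc P)) => t0 x0 a.
  partial_lra.
(* On an empty slab any constants do. *)
have [[P0 JP0]|noP] := pselect (exists P, slab J P); last first.
  by exists 0, 0, 0, 0 => P JP; case: noP; exists P.
pose t0 := tc (Y P0); pose x0 := xc (Y P0).
have t0E P : slab J P -> Y P 0 (inord 0) = t0.
  move=> JP; have D Q (JQ : slab J Q) := let: And4 d _ _ _ := S Q JQ in d.
  have -> := affine_of_partials J_itv (Ysm (inord 0)) D JP0 JP.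
  by rewrite !mul0r !addr0.
have x0E P : slab J P -> Y P 0 (inord 1) = x0.
  move=> JP; have D Q (JQ : slab J Q) := let: And4 _ d _ _ := S Q JQ in d.
  have -> := affine_of_partials J_itv (Ysm (inord 1)) D JP0 JP.
  by rewrite !mul0r !addr0.
pose d2 := G * t0 - x0 - b * t0; pose d3 := G * t0 - x0.
(* The additive constants make the affine components agree with [Y] at [P0]. *)
exists t0, x0, (yc (Y P0) - d2 * yc P0), (zc (Y P0) - d3 * zc P0) => P JP.
rewrite [LHS]row4_eta /affine_field (t0E P JP) (x0E P JP).
rewrite -/d2 -/d3; congr (row4 _ _ _ _).
- have D Q (JQ : slab J Q) : [/\ partial (inord 0) (fun Q => Y Q 0 (inord 2)) Q = 0,
      partial (inord 1) (fun Q => Y Q 0 (inord 2)) Q = 0,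
      partial (inord 2) (fun Q => Y Q 0 (inord 2)) Q = d2 &
      partial (inord 3) (fun Q => Y Q 0 (inord 2)) Q = 0].
    have [_ _ [e0 e1 e2 e3] _] := S Q JQ.
    by split; [exact: e0|exact: e1|rewrite e2 t0E // x0E|exact: e3].
  have -> := affine_of_partials J_itv (Ysm (inord 2)) D JP0 JP.
  by rewrite /yc; move: d2 {D} => d2; ring.
- have D Q (JQ : slab J Q) : [/\ partial (inord 0) (fun Q => Y Q 0 (inord 3)) Q = 0,
      partial (inord 1) (fun Q => Y Q 0 (inord 3)) Q = 0,
      partial (inord 2) (fun Q => Y Q 0 (inord 3)) Q = 0 &
      partial (inord 3) (fun Q => Y Q 0 (inord 3)) Q = d3].
    have [_ _ _ [e0 e1 e2 e3]] := S Q JQ.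
    by split; [exact: e0|exact: e1|exact: e2|rewrite e3 t0E // x0E].
  have -> := affine_of_partials J_itv (Ysm (inord 3)) D JP0 JP.
  by rewrite /zc; move: d3 {D} => d3; ring.
Qed.

Lemma L1_affine : L1 m lam = affine_field (2 / m) 0 1 0 lam 0.
Proof. by apply/funext => P; rewrite /L1 /affine_field mul1r !addr0. Qed.

Lemma L1_ckv : CKV (slab J) (bianchiV A Gam B) (L1 m lam)
  (fun P => psiV m lam A (tc P)).
Proof.
rewrite L1_affine; split; first exact: vector_field_affine.
move=> P JP; apply/(conformal_eqs_expR _ _ JP).
rewrite [tc (affine_field _ _ _ _ _ _ _)]row4E [xc (affine_field _ _ _ _ _ _ _)]row4E.
by apply: conformal_eqs_affine; rewrite /psiV; move: (_ / A _) => a; field.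
Qed.

(** These are the symmetries of the Bianchi V group: translations in y and z, and a translation in x
    compensated by scaling y and z. *)
Lemma killing_affine (x0 e2 e3 : R) :
  KV (slab J) (bianchiV A Gam B) (affine_field 0 x0 (- x0) e2 (- x0) e3).
Proof.
split; first exact: vector_field_affine.
move=> P JP; apply/(conformal_eqs_expR _ _ JP).
rewrite [tc (affine_field _ _ _ _ _ _ _)]row4E [xc (affine_field _ _ _ _ _ _ _)]row4E.
by apply: conformal_eqs_affine; ring.
Qed.

Lemma ckv_unique (Y : 'rV[R]_4 -> 'rV[R]_4) (phi : 'rV[R]_4 -> R) :
  lam != 1 -> m ^+ 2 * lam != 4 ->
  CKV (slab J) (bianchiV A Gam B) Y phi ->
  exists c K, KV (slab J) (bianchiV A Gam B) K /\
    forall P, slab J P -> Y P = c *: L1 m lam P + K P.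
Proof.
move=> lam1 mlam /(ckv_affine lam1 mlam)[t0 [x0 [e2 [e3 YE]]]].
(* The t-component of [L1] is 2 / m, so this multiple removes the t-component of [Y]; the remainder
   has the form in [killing_affine]. *)
exists (m * t0 / 2), (affine_field 0 x0 (- x0) e2 (- x0) e3).
split=> [|P JP]; first exact: killing_affine.
by rewrite YE //; apply/rowP; apply: ord4P; rewrite !mxE !inordK //=; field.
Qed.

End Uniqueness.

(** * The Hessian of the conformal factor *)

Lemma invmx_diag (R : fieldType) (n : nat) (v : 'rV[R]_n) :
  (forall i, v 0 i != 0) -> invmx (diag_mx v) = diag_mx (\row_i (v 0 i)^-1).
Proof.
move=> v0; have E : diag_mx v *m diag_mx (\row_i (v 0 i)^-1) = 1%:M.
  rewrite mulmx_diag -diag_const_mx; congr diag_mx.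
  by apply/rowP => i; rewrite !mxE mulfV.
have [U _] := mulmx1_unit E.
by rewrite -[RHS](mulKmx U) E mulmx1.
Qed.

Lemma is_derive_tc (R : realType) (f : R -> R) (df : R) (P : 'rV[R]_4) i :
  is_derive (tc P) 1 f df ->
  is_derive P (delta_mx 0 i) (fun Q => f (tc Q)) (df * (inord 0 == i)%:R).
Proof. exact: (is_derive_comp1 (is_derive_coord (inord 0) i P)). Qed.

Lemma itv_derive0_cst (R : realType) (J : set R) (f : R -> R) :
  is_interval J -> (forall t, J t -> is_derive t 1 f 0) ->
  forall s t, J s -> J t -> f s = f t.
Proof.
move=> iJ Hf s t Js Jt.
(* Points of the t-axis embed [J] in the slab, so the four-variable result applies. *)
pose e (r : R) := row4 r 0 0 0.
have tce r : tc (e r) = r by rewrite /tc row4E.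
have := @affine_of_cst_derive R J iJ (fun Q => f (tc Q)) (fun=> 0) (e t) (e s).
rewrite !tce big1 ?addr0 => [|i _]; last exact: mul0r.
apply=> [Q i JQ| |]; try by rewrite /slab /= tce.
by have := is_derive_tc i (Hf _ JQ); rewrite mul0r.
Qed.

Lemma partial_tc0 (R : realType) (f : R -> R) (P : 'rV[R]_4) i :
  inord 0 != i -> partial i (fun Q => f (tc Q)) P = 0.
Proof.
move=> i0; apply: derive_eq_cst_line => s.
by rewrite tc_line (negPf i0) mulr0 add0r.
Qed.

Lemma christoffel_diag (R : realType) (w : 'I_4 -> 'rV[R]_4 -> R) (P : 'rV[R]_4) i j :
  (forall a, w a P != 0) -> i != j ->
  christoffel (fun Q => diag_mx (\row_a w a Q)) i j j P =
  - (2^-1 * (w i P)^-1 * partial i (w j) P).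
Proof.
move=> w0 ij; rewrite /christoffel invmx_diag => [|a]; last by rewrite mxE.
have off a b : a != b -> (fun Q => diag_mx (\row_a w a Q) a b) = fun=> 0.
  by move=> ab; apply/funext => Q; rewrite !mxE (negPf ab) mulr0n.
have on a : (fun Q => diag_mx (\row_a w a Q) a a) = w a.
  by apply/funext => Q; rewrite !mxE eqxx mulr1n.
rewrite (bigD1 i) //= big1 ?addr0 => [|d di].
  rewrite !mxE eqxx mulr1n (off i j) // (off j i) 1?eq_sym // on !partial_cst.
  by rewrite addr0 sub0r !mulrN mulrA.
by rewrite !mxE eq_sym (negPf di) mulr0n mul0r.
Qed.

(** Look at the zz component. As p depends on t only, its second partial vanishes and the only
    contribution is through the Christoffel symbol with upper index t, proportional to A A'. *)
Lemma cov_hessian_tc (R : realType) (A Gam B p : R -> R) (dA dp : R) (P : 'rV[R]_4) :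
  A (tc P) != 0 -> Gam (tc P) != 0 -> B (tc P) != 0 ->
  is_derive (tc P) 1 A dA -> is_derive (tc P) 1 p dp ->
  cov_hessian (bianchiV A Gam B) (fun Q => p (tc Q)) P = 0 -> dA * dp = 0.
Proof.
move=> A0 G0 B0 HA Hp H.
have F0 a : bianchi_fun A Gam B a (tc P) != 0.
  move: a; apply: ord4P; rewrite bianchi_funE ?oppr_eq0 ?expf_neq0 //;
  by rewrite mulf_neq0.
have w0 a : warp (bianchi_fun A Gam B a) (bianchi_exp R a) P != 0 by exact: warp_neq0.
have tz : inord 0 != inord 3 :> 'I_4 by rewrite inord4_eq.
move/matrixP/(_ (inord 3) (inord 3)): H; rewrite !mxE bianchiV_diag.
have -> : partial (inord 3) (fun Q => p (tc Q)) = fun=> 0.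
  by apply/funext => Q; exact: partial_tc0.
rewrite partial_cst sub0r (bigD1 (inord 0)) //= big1 ?addr0 => [|c c0]; last first.
  by rewrite partial_tc0 ?mulr0 // eq_sym.
rewrite (christoffel_diag w0 tz).
have [_ pE] := is_derive_tc (inord 0) Hp; rewrite /partial pE -/(partial _ _ _).
have HF : is_derive (tc P) 1 (bianchi_fun A Gam B (inord 3)) (2 * A (tc P) * dA).
  by rewrite bianchi_funE; exact: is_derive_sqr.
rewrite (partial_warp _ _ HF) inord4_eq // eqxx mulr1 mulNr opprK mul1r.
rewrite (_ : (inord 1 == inord 0 :> 'I_4) = false) ?inord4_eq // !mul0r addr0.
move: (w0 (inord 0)); move: (warp _ _ P) => w w1.
have E0 : expR (bianchi_exp R (inord 3) * xc P) != 0 by rewrite gt_eqF // expR_gt0.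
move: (expR _) (A _) E0 A0 => E a E0 A0 H.
(* This is the nonvanishing coefficient of A' p' in the zz component, [w] being g_tt. *)
have K : a * E / w != 0 by rewrite !mulf_neq0 // invr_neq0.
by apply: (mulfI K); rewrite mulr0 -[RHS]H; field.
Qed.

Lemma derivable_psiV (R : realType) (m lam : R) (A : R -> R) (t : R) :
  A t != 0 -> derivable A t 1 -> derivable (derive1 A) t 1 ->
  exists2 du, is_derive t 1 (fun s => derive1 A s / A s) du &
    is_derive t 1 (psiV m lam A) (2 / m * du).
Proof.
move=> A0 dA ddA.
have du : derivable (derive1 A * (fun s => (A s)^-1)) t 1.
  exact: (derivableM ddA (derivableV A0 dA)).
exists ('D_1 (derive1 A * (fun s => (A s)^-1)) t); first exact: derivableP.
have := is_derive_add (is_derive_scale (2 / m) (derivableP du))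
  (is_derive_const t 1 lam).
by rewrite addr0.
Qed.

Lemma psiV_cst (R : realType) (m lam : R) (J : set R) (A Gam B : R -> R) :
  m != 0 -> is_interval J ->
  (forall t, J t -> derivable A t 1) -> (forall t, J t -> derivable (derive1 A) t 1) ->
  (forall t, J t -> A t != 0) -> (forall t, J t -> Gam t != 0) ->
  (forall t, J t -> B t != 0) ->
  (forall P, slab J P ->
     cov_hessian (bianchiV A Gam B) (fun Q => psiV m lam A (tc Q)) P = 0) ->
  exists k, forall t, J t -> psiV m lam A t = k.
Proof.
move=> m0 iJ dA ddA A0 G0 B0 H.
pose u s := derive1 A s / A s.
have U t : J t -> exists2 du, is_derive t 1 u du & u t * du = 0.
  move=> Jt; have [du Du Dp] := derivable_psiV m lam (A0 t Jt) (dA t Jt) (ddA t Jt).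
  exists du => //; pose P := row4 t 0 0 0.
  have tP : tc P = t by rewrite /tc row4E.
  have DA : is_derive t 1 A (derive1 A t) by rewrite derive1E; exact: derivableP (dA t Jt).
  have := @cov_hessian_tc R A Gam B (psiV m lam A) (derive1 A t) (2 / m * du) P.
  rewrite tP => /(_ (A0 t Jt) (G0 t Jt) (B0 t Jt) DA Dp).
  have JP : slab J P by rewrite /slab /= tP.
  move=> /(_ (H P JP)) /eqP; rewrite mulrCA mulf_eq0 => /orP[|/eqP Adu].
    by rewrite mulf_eq0 invr_eq0 (negPf m0) (negPf (_ : 2 != 0 :> R)).
  by rewrite /u mulrAC Adu mul0r.
have U2 s t : J s -> J t -> u s ^+ 2 = u t ^+ 2.
  apply: (@itv_derive0_cst R J (fun s => u s ^+ 2) iJ) => r Jr.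
  have [du Du udu] := U r Jr.
  by apply: (is_derive_eq (is_derive_sqr Du)); rewrite -mulrA udu mulr0.
have uc s t : J s -> J t -> u s = u t.
  (* If u is nonzero somewhere, constancy of u^2 makes it nonzero everywhere and u u' = 0 forces u'
     = 0; otherwise u is identically zero. *)
  have [[r Jr ur]|u0] := pselect (exists2 r, J r & u r != 0); last first.
    have z r : J r -> u r = 0.
      by move=> Jr; apply/eqP/negPn/negP => ur; apply: u0; exists r.
    by move=> Js Jt; rewrite !z.
  apply: (itv_derive0_cst iJ) => q Jq; have [du Du udu] := U q Jq.
  apply: (is_derive_eq Du).
  have : u q != 0 by rewrite -sqrf_eq0 (U2 q r Jq Jr) sqrf_eq0.
  by move=> uq; apply: (mulfI uq); rewrite udu mulr0.
have [[t Jt]|noJ] := pselect (exists t, J t); last first.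
  by exists 0 => t Jt; case: noJ; exists t.
exists (psiV m lam A t) => s Js; rewrite /psiV -/(u s) -/(u t).
by rewrite (uc s t Js Jt).
Qed.

(** * Gauge and the ordinary differential equations for Gam and B *)

Lemma jacobian_rescale (R : realType) (p q : R) (P : 'rV[R]_4) :
  jacobian (rescale p q) P = diag_mx (row4 1 1 p q).
Proof.
pose d (i : 'I_4) : R := row4 1 1 p q 0 i.
have coordE i : (fun Q : 'rV[R]_4 => rescale p q Q 0 i) = fun Q => d i * Q 0 i + 0.
  by apply/funext => Q; move: i; apply: ord4P; rewrite /d !row4E ?mul1r addr0.
have dif : differentiable (rescale p q) P.
  rewrite (_ : rescale p q = \sum_i (fun Q : 'rV[R]_4 => (d i * Q 0 i) *: delta_mx 0 i)).
    apply: differentiable_sum => i; apply: differentiableZl.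
    by apply: differentiableZ; exact: differentiable_coord.
  apply/funext => Q; rewrite fct_sumE [LHS]row_sum_delta.
  by apply: eq_bigr => i _; rewrite (congr1 (fun f => f Q) (coordE i)) addr0.
apply/matrixP => i j.
transitivity (row i (jacobian (rescale p q) P) 0 j); first by rewrite [RHS]mxE.
rewrite rowE -(deriveEjacobian _ dif) derive_mx; last exact: diff_derivable.
rewrite [LHS]mxE coordE [LHS]partial_affine_coord [RHS]mxE eq_sym mulr_natr.
by have [->|] := eqVneq i j.
Qed.

Lemma pullback_rescale (R : realType) (A Gam B : R -> R) (p q : R) (P : 'rV[R]_4) :
  q != 0 ->
  pullback (rescale p q) (bianchiV A Gam B) P =
  bianchiV (fun t => q * A t) (fun t => Gam t / q) (fun t => p / q * B t) P.
Proof.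
move=> q0; rewrite /pullback jacobian_rescale tr_diag_mx /bianchiV.
rewrite -scalemxAr -scalemxAl !mulmx_diag.
apply/matrixP => i j; rewrite !mxE.
have -> : tc (rescale p q P) = tc P by rewrite {1}/tc row4E.
have -> : xc (rescale p q P) = xc P by rewrite {1}/xc row4E.
case: (i == j); last by rewrite !mulr0n !mulr0.
by rewrite !mulr1n; move: i; apply: ord4P; rewrite !inordK //=; field.
Qed.

Lemma rescale_preserves_L1 (R : realType) (m lam p q : R) (P : 'rV[R]_4) :
  preserves_field (rescale p q) (L1 m lam) P.
Proof.
rewrite /preserves_field jacobian_rescale mul_mx_diag.
apply/rowP; apply: ord4P; rewrite !mxE !inordK //=; rewrite ?/yc ?/zc ?row4E ?/yc ?/zc; ring.
Qed.

(** The function e^{- c t / 2} f is constant on the interval; [k] is the absolute value of that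
    constant, hence positive, and its sign is lost in the square. *)
Lemma sqr_expR_of_log_derive (R : realType) (J : set R) (f : R -> R) (c : R) :
  is_interval J -> (forall t, J t -> f t != 0) ->
  (forall t, J t -> is_derive t 1 f (c / 2 * f t)) ->
  exists2 k, 0 < k & forall t, J t -> (f t / k) ^+ 2 = expR (c * t).
Proof.
move=> iJ f0 Hf.
have [[t0 Jt0]|noJ] := pselect (exists t, J t); last first.
  by exists 1 => // t Jt; case: noJ; exists t.
pose h t := expR (- (c / 2) * t) * f t.
have hc t : J t -> h t = h t0.
  move=> Jt; apply: (itv_derive0_cst iJ _ Jt Jt0) => s Js.
  have De := is_derive_comp1 (is_derive_scale (- (c / 2)) (is_derive_id s (1 : R)))
    (is_derive_expR (- (c / 2) * s)).
  by apply: (is_derive_eq (is_derive_mul De (Hf s Js))); move: (expR _) => e; ring.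
have h0 : h t0 != 0 by rewrite mulf_neq0 ?f0 // gt_eqF // expR_gt0.
exists `|h t0|; first by rewrite normr_gt0.
move=> t Jt; rewrite expr_div_n real_normK ?num_real // -(hc t Jt) /h exprMn.
rewrite -expRM_natl (_ : 2 * _ = - (c * t)); last by field.
rewrite expRN invfM invrK mulrCA divff ?mulr1 //.
by rewrite expf_neq0 // f0.
Qed.

(** The zz equation determines the conformal factor. Subtracting it from the tt and yy equations
    leaves the logarithmic derivatives of Gam and B. *)
Lemma L1_ckv_only (R : realType) (m lam : R) (J : set R) (A Gam B : R -> R)
    (psi : 'rV[R]_4 -> R) (t : R) :
  m != 0 -> J t -> derivable A t 1 -> derivable Gam t 1 -> derivable B t 1 ->
  A t != 0 -> Gam t != 0 -> B t != 0 ->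
  CKV (slab J) (bianchiV A Gam B) (L1 m lam) psi ->
  [/\ forall P, tc P = t -> psi P = psiV m lam A t,
      is_derive t 1 Gam (m * lam / 2 * Gam t) &
      is_derive t 1 B (m * (lam - 1) / 2 * B t)].
Proof.
move=> m0 Jt dA dG dB A0 G0 B0 [_ Hck].
have D (f : R -> R) : derivable f t 1 -> f t != 0 -> is_derive t 1 f (derive1 f t / f t * f t).
  by move=> df f0; rewrite divfK // derive1E; exact: derivableP.
have E P : tc P = t -> conformal_eqs Gam B (derive1 A t / A t) (derive1 Gam t / Gam t)
    (derive1 B t / B t) (expR (2 * xc P)) (2 / m) 0
    (fun i j => jac (affine_field (2 / m) 0 1 0 lam 0) P (inord i) (inord j)) (psi P) t.
  move=> tP; have JP : slab J P by rewrite /slab /= tP.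
  have := Hck P JP; rewrite L1_affine.
  have HA := D _ dA A0; have HG := D _ dG G0; have HB := D _ dB B0.
  rewrite -tP in A0 G0 B0 HA HG HB *.
  move/(conformal_eqsP _ _ A0 G0 B0 HA HG HB).
  by rewrite [tc (affine_field _ _ _ _ _ _ _)]row4E [xc (affine_field _ _ _ _ _ _ _)]row4E.
have F P : tc P = t -> [/\ 2 / m * (derive1 A t / A t + derive1 Gam t / Gam t) = psi P,
    2 / m * (derive1 A t / A t + derive1 B t / B t) + 1 = psi P &
    2 / m * (derive1 A t / A t) + lam = psi P].
  move=> /E[[h0 _ h2 h3] _ _ _ _]; move: h0 h2 h3; rewrite !jac_affine //=.
  by rewrite ?(mulr0n, mulr1n, mul0r, mulr0, mulr1, addr0).
have t0 : tc (row4 t 0 0 0) = t by rewrite /tc row4E.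
have [h0 h2 h3] := F _ t0.
split=> [P /F[_ _ <-] //| |].
- apply: (is_derive_eq (D _ dG G0)); congr (_ * _).
  move: (etrans h0 (esym h3)); rewrite mulrDr => /addrI <-.
  by move: (derive1 Gam t / Gam t) => g; field.
- apply: (is_derive_eq (D _ dB B0)); congr (_ * _).
  move: (etrans h2 (esym h3)); rewrite mulrDr -addrA => /addrI <-.
  by move: (derive1 B t / B t) => b; field.
Qed.

Theorem proposition2 (R : realType) (m lam : R) (J : set R) (A Gam B : R -> R)
    (hm : m != 0) (J_open : open J) (J_itv : is_interval J)
    (A_smooth : smooth1 J A) (Gam_smooth : smooth1 J Gam)
    (B_smooth : smooth1 J B)
    (A_neq0 : forall t, J t -> A t != 0)
    (Gam_neq0 : forall t, J t -> Gam t != 0)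
    (B_neq0 : forall t, J t -> B t != 0) :
  [/\ (* L1 is a CKV only for the stated Gam and B, up to rescaling y and z *)
      forall psi, CKV (slab J) (bianchiV A Gam B) (L1 m lam) psi ->
        (forall P, slab J P -> psi P = psiV m lam A (tc P)) /\
        exists p q : R,
          [/\ 0 < p /\ 0 < q,
              forall P, slab J P ->
                pullback (rescale p q) (bianchiV A Gam B) P =
                bianchiV (fun t => q * A t) (fun t => Gam t / q)
                         (fun t => p / q * B t) P,
              forall P, slab J P -> preserves_field (rescale p q) (L1 m lam) P,
              forall t, J t -> (Gam t / q) ^+ 2 = expR (m * lam * t) &
              forall t, J t -> (p / q * B t) ^+ 2 = expR (m * (lam - 1) * t)],
      (* conversely, it is then a CKV, proper unless homothetic, and unique *)
      (forall t, J t -> Gam t ^+ 2 = expR (m * lam * t)) ->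
      (forall t, J t -> B t ^+ 2 = expR (m * (lam - 1) * t)) ->
        [/\ CKV (slab J) (bianchiV A Gam B) (L1 m lam)
                (fun P => psiV m lam A (tc P)),
            ~ (exists k, forall t, J t -> psiV m lam A t = k) ->
              proper_CKV (slab J) (bianchiV A Gam B) (L1 m lam)
                         (fun P => psiV m lam A (tc P)) &
            ~ (exists k, forall t, J t -> psiV m lam A t = k) ->
            lam != 1 -> m ^+ 2 * lam != 4 ->
              unique_proper_CKV (slab J) (bianchiV A Gam B) (L1 m lam)
                                (fun P => psiV m lam A (tc P))] &
      (* homothetic case *)
      forall kap : R, kap != 0 ->
        (forall t, J t -> Gam t ^+ 2 = expR (m * lam * t)) ->
        (forall t, J t -> B t ^+ 2 = expR (m * (lam - 1) * t)) ->
        (forall t, J t -> A t ^+ 2 = expR (m * (kap - lam) * t)) ->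
          HV (slab J) (bianchiV A Gam B) (L1 m lam) kap /\
          forall t, J t -> psiV m lam A t = kap].
Proof.
have A_der t : J t -> derivable A t 1 by move=> Jt; exact: (A_smooth 0%N).
have A_der2 t : J t -> derivable (derive1 A) t 1.
  by move=> Jt; have := A_smooth 1%N t Jt; rewrite derive1n1.
have Gam_der t : J t -> derivable Gam t 1 by move=> Jt; exact: (Gam_smooth 0%N).
have B_der t : J t -> derivable B t 1 by move=> Jt; exact: (B_smooth 0%N).
split.
- move=> psi Hck.
  have L t (Jt : J t) := L1_ckv_only hm Jt (A_der t Jt) (Gam_der t Jt) (B_der t Jt)
    (A_neq0 t Jt) (Gam_neq0 t Jt) (B_neq0 t Jt) Hck.
  split; first by move=> P JP; have [E _ _] := L _ JP; exact: E.
  have [q q0 HG] : exists2 q, 0 < q &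
      forall t, J t -> (Gam t / q) ^+ 2 = expR (m * lam * t).
    by apply: sqr_expR_of_log_derive => // t /L[].
  have [r r0 HB] : exists2 r, 0 < r &
      forall t, J t -> (B t / r) ^+ 2 = expR (m * (lam - 1) * t).
    by apply: sqr_expR_of_log_derive => // t /L[].
  have qn0 : q != 0 by rewrite gt_eqF.
  (* Gam is normalised by [q] and B by [r], so p / q must equal 1 / r. *)
  exists (q / r), q; split=> //.
  + by rewrite divr_gt0.
  + by move=> P _; exact: pullback_rescale.
  + by move=> P _; exact: rescale_preserves_L1.
  + move=> t Jt; rewrite -HB //; congr (_ ^+ 2).
    by field; rewrite qn0 gt_eqF.
- move=> GamE BE.
  have ckv := L1_ckv hm J_open A_der Gam_der B_der A_neq0 Gam_neq0 B_neq0 GamE BE.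
  have proper : ~ (exists k, forall t, J t -> psiV m lam A t = k) ->
      proper_CKV (slab J) (bianchiV A Gam B) (L1 m lam) (fun P => psiV m lam A (tc P)).
    (* By contraposition: an identically vanishing Hessian would make the conformal factor
       constant. *)
    move=> ncst; split=> //; apply: contrapT => H; apply: ncst.
    apply: (psiV_cst hm J_itv A_der A_der2 A_neq0 Gam_neq0 B_neq0) => P JP.
    by apply/eqP/negPn/negP => HP; apply: H; exists P.
  split=> // ncst lam1 mlam; split; first exact: proper.
  move=> Y phi [Yck _].
  exact: (ckv_unique hm J_open J_itv A_der Gam_der B_der A_neq0 Gam_neq0 B_neq0
    GamE BE lam1 mlam Yck).
- move=> kap _ GamE BE AE.
  have psiE t : J t -> psiV m lam A t = kap.
    move=> Jt.
    (* The logarithmic derivative of A is m (kap - lam) / 2, which makes the conformal factor (kap -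
       lam) + lam. *)
    have [_ dA] := is_derive_of_sqr_expR J_open Jt (A_der t Jt) (A_neq0 t Jt) AE.
    rewrite /psiV derive1E dA mulfK ?A_neq0 //; by field.
  have [vf ckv] := L1_ckv hm J_open A_der Gam_der B_der A_neq0 Gam_neq0 B_neq0 GamE BE.
  by split=> //; split=> // P JP; rewrite ckv // psiE.
Qed.
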